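(* Let $X$ be a Polish space, $d\in\mathbb{N}$, and let $G$ be a bipartite one-ended $d$-regular Borel graph on $X$. Then there is a $G$-invariant comeagre Borel set $X'\subseteq X$ such that $G|_{X'}$ has a Borel perfect matching.
   Context: A Borel graph $G$ on a Polish space $X$ is a (simple, undirected) graph with vertex set $X$ whose edge set is a Borel subset of $X^2$. Bipartite is meant in the usual graph-theoretic sense (no odd cycles); no Borel bipartition is assumed. A connected graph is one-ended if for every finite set $F$ of vertices the induced subgraph on the complement of $F$ has exactly one infinite connected component; a non-connected graph is one-ended if each of its connected components is. A set is $G$-invariant if it is a union of connected components of $G$; $G|_{X'}$ is the induced subgraph on $X'$. A Borel perfect matching is a Borel set of edges such that every vertex lies in exactly one edge of the set. *)

(* Defs.v *)
From mathcomp Require Import all_boot all_order all_algebra.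
From mathcomp Require Import all_classical all_reals all_analysis.

Set Implicit Arguments.
Unset Strict Implicit.
Unset Printing Implicit Defensive.

Import Order.TTheory GRing.Theory Num.Theory.

Local Open Scope classical_set_scope.

Definition separable (T : topologicalType) : Prop :=
  exists2 D : set T, countable D & dense D.

Definition complete_metric (R : realType) (M : metricType R) : Prop :=
  forall u : nat -> M, cauchy (u @ \oo) -> exists l : M, u @ \oo --> l.

Definition homeomorphic (S T : topologicalType) : Prop :=
  exists (f : S -> T) (g : T -> S),
    [/\ cancel f g, cancel g f, continuous f & continuous g].

(* The metric is existentially quantified, so being Polish only depends on the
   topology; the empty space is Polish. *)
Definition polish (R : realType) (X : topologicalType) : Prop :=
  separable X /\ exists M : metricType R, complete_metric M /\ homeomorphic X M.

Definition borel (T : topologicalType) : set (set T) := <<s @open T >>.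

Definition nowhere_dense (T : topologicalType) (A : set T) : Prop :=
  (closure A)° = set0.

Definition meagre (T : topologicalType) (A : set T) : Prop :=
  exists2 F : nat -> set T,
    (forall n, nowhere_dense (F n)) & A = \bigcup_n F n.

Definition comeagre (T : topologicalType) (A : set T) : Prop := meagre (~` A).

(* A graph on T is given by its edge set, as a set of ordered pairs: an
   undirected edge {x, y} is represented by both (x, y) and (y, x). *)
Definition simple_graph (T : Type) (E : set (T * T)) : Prop :=
  (forall x, ~ E (x, x)) /\ (forall x y, E (x, y) -> E (y, x)).

Definition borel_graph (X : topologicalType) (E : set (X * X)) : Prop :=
  simple_graph E /\ borel E.

Definition adj (T : Type) (E : set (T * T)) : rel T :=
  fun x y => (x, y) \in E.

Definition regular_graph (T : Type) (d : nat) (E : set (T * T)) : Prop :=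
  forall x, ([set y | E (x, y)] #= `I_d)%card.

Definition bipartite (T : eqType) (E : set (T * T)) : Prop :=
  forall c : seq T, (2 < size c)%N -> ucycle (adj E) c -> ~~ odd (size c).

(* The edge set of the subgraph induced on the vertex set V. *)
Definition induced_edges (T : Type) (V : set T) (E : set (T * T)) : set (T * T) :=
  E `&` (V `*` V).

Definition component_of (T : Type) (E : set (T * T)) (x : T) : set T :=
  [set y | exists2 p : seq T, path (adj E) x p & last x p = y].

(* The vertex sets of the connected components of the subgraph induced on V. *)
Definition components (T : Type) (V : set T) (E : set (T * T)) :
    set (set T) :=
  [set component_of (induced_edges V E) x | x in V].

(* One-endedness of the subgraph induced on V, when that subgraph is
   connected. *)
Definition one_ended_on (T : Type) (V : set T) (E : set (T * T)) : Prop :=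
  forall F : set T, finite_set F -> F `<=` V ->
    exists! C : set T, components (V `\` F) E C /\ infinite_set C.

Definition one_ended (T : Type) (E : set (T * T)) : Prop :=
  forall C, components setT E C -> one_ended_on C E.

Definition invariant_set (T : Type) (E : set (T * T)) (A : set T) : Prop :=
  exists2 S : set (set T), S `<=` components setT E & A = \bigcup_(C in S) C.

(* M is a Borel perfect matching of the subgraph induced on A: like E, it is a
   symmetric set of ordered pairs, so the edges of M containing x correspond to
   the y such that M (x, y). *)
Definition borel_perfect_matching (X : topologicalType) (A : set X)
    (E M : set (X * X)) : Prop :=
  [/\ borel M,
      M `<=` induced_edges A E,
      forall x y, M (x, y) -> M (y, x) &
      forall x, A x -> exists! y, M (x, y)].

(* Main.v *)
Require Import Defs.
From mathcomp Require Import all_boot all_order all_algebra.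
From mathcomp Require Import all_classical all_reals all_analysis.
From mathcomp Require Import lra zify.

(* Weights [w : X -> X -> int] with values in [0, d] that sum to [d] at every
   vertex are fractional perfect matchings; we start from the constant weight 1
   and round it. Call an edge open when its weight is strictly between 0 and [d].
   By bipartiteness the signed sum of the weights leaving a finite set vanishes
   modulo [d], so no open edge is a bridge with a finite side; one-endedness of
   the open edges excludes bridges with two infinite sides. Hence every open edge
   lies on a finite cycle of open edges, and pushing one unit at most [d] times
   along such cycles closes any prescribed edge by a finite change of [w].

   Such a change can be done at all points of a set that is sparse enough, and
   it keeps the open edges one-ended if the infinite part of the open graph stays
   connected inside the finite set where the change takes place. The changes are
   described by countably many codes, so [X] is covered by countably many Borel
   sets on each of which one code applies sparsely. At each stage we pick one of
   these sets that is nonmeagre in a given basic open set; by the Baire property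
   comeagrely many points then have all edges of their component eventually
   closed, which leaves the weight [d] on a perfect matching.

   Analyticity replaces Lusin-Novikov uniformization: having a neighbour in a
   Borel set is analytic and, by [d]-regularity, so is its complement. *)

Set Implicit Arguments.
Unset Strict Implicit.
Unset Printing Implicit Defensive.
Import Order.TTheory GRing.Theory Num.Theory.
Local Open Scope classical_set_scope.

(** * Borel and analytic sets *)

Section BorelSets.
Context {T : topologicalType}.
Implicit Types A B : set T.

Lemma borel_open A : open A -> borel A.
Proof. by move=> oA; apply: (@sub_sigma_algebra T setT open). Qed.

Lemma borelC A : borel A -> borel (~` A).
Proof. by move=> bA; rewrite -setTD; apply: (@sigma_algebraCD T setT open). Qed.

Lemma borel_bigcup (F : nat -> set T) :
  (forall n, borel (F n)) -> borel (\bigcup_n F n).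
Proof. exact: (@sigma_algebra_bigcup T setT open). Qed.

Lemma borel_ind (P : set (set T)) :
  (forall A, open A -> P A) -> (forall A, P A -> P (~` A)) ->
  (forall F : nat -> set T, (forall n, P (F n)) -> P (\bigcup_n F n)) ->
  forall A, borel A -> P A.
Proof.
move=> PO PC PU A; apply; split=> //; split=> //.
- exact/PO/open0.
- by move=> B PB; rewrite setTD; apply: PC.
Qed.

Lemma borel_set0 : borel (@set0 T).
Proof. by apply: borel_open; apply: open0. Qed.

(** With [borel_all] and the connectives below, Borelness is read off from a formula whose
    quantifiers range over countable types. *)
Lemma borel_ex (I : countType) (P : I -> T -> Prop) :
  (forall i, borel [set x | P i x]) -> borel [set x | exists i, P i x].
Proof.
move=> bP; pose F n := if unpickle n is Some i then [set x | P i x] else set0.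
suff -> : [set x | exists i, P i x] = \bigcup_n F n.
  apply: borel_bigcup => n; rewrite /F; case: unpickle => [i|] //.
  exact: borel_set0.
apply/seteqP; split=> [x [i Pix]|x [n _]].
  by exists (pickle i) => //; rewrite /F pickleK.
by rewrite /F; case: unpickle => // i Pix; exists i.
Qed.

Lemma borel_not (P : T -> Prop) : borel [set x | P x] -> borel [set x | ~ P x].
Proof. exact: borelC. Qed.

Lemma borel_all (I : countType) (P : I -> T -> Prop) :
  (forall i, borel [set x | P i x]) -> borel [set x | forall i, P i x].
Proof.
move=> bP; suff -> : [set x | forall i, P i x] = [set x | ~ exists i, ~ P i x].
  by apply: borel_not; apply: borel_ex => i; apply: borel_not.
apply/seteqP; split=> x /= H; first by case=> i; apply.
by move=> i; apply: contrapT => nP; apply: H; exists i.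
Qed.

Lemma borel_const (P : Prop) : borel [set _ : T | P].
Proof.
have [p|np] := pselect P.
  by rewrite (_ : [set _ | P] = setT); [apply: borel_open; apply: openT | apply/seteqP; split].
by rewrite (_ : [set _ | P] = set0); [exact: borel_set0 | apply/seteqP; split].
Qed.

Lemma borel_or (P Q : T -> Prop) : borel [set x | P x] -> borel [set x | Q x] ->
  borel [set x | P x \/ Q x].
Proof.
move=> bP bQ.
suff -> : [set x | P x \/ Q x] = [set x | exists b : bool, if b then P x else Q x].
  by apply: borel_ex; case.
apply/seteqP; split=> x /=.
  by case; [exists true|exists false].
by case; case; [left|right].
Qed.

Lemma borel_and (P Q : T -> Prop) : borel [set x | P x] -> borel [set x | Q x] ->
  borel [set x | P x /\ Q x].
Proof.
move=> bP bQ.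
suff -> : [set x | P x /\ Q x] = [set x | forall b : bool, if b then P x else Q x].
  by apply: borel_all; case.
apply/seteqP; split=> x /=; first by move=> [px qx]; case.
by move=> H; split; [apply: (H true)|apply: (H false)].
Qed.

Lemma borel_imp (P Q : T -> Prop) : borel [set x | P x] -> borel [set x | Q x] ->
  borel [set x | P x -> Q x].
Proof.
move=> bP bQ.
suff -> : [set x | P x -> Q x] = [set x | ~ P x \/ Q x].
  by apply: borel_or => //; apply: borel_not.
apply/seteqP; split=> x /=; last by case.
by move=> H; have [/H|] := pselect (P x); [right|left].
Qed.

End BorelSets.

Lemma borel_preimage (S T : topologicalType) (f : S -> T) (A : set T) :
  continuous f -> borel A -> borel (f @^-1` A).
Proof.
move=> cf; apply: (borel_ind (P := fun A => borel (f @^-1` A))).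
- by move=> B oB; apply: borel_open; move/continuousP: cf; apply.
- by move=> B; apply: borelC.
- by move=> F bF; rewrite preimage_bigcup; apply: borel_bigcup.
Qed.

Lemma hausdorff_separate (T : topologicalType) (x y : T) :
  hausdorff_space T -> x <> y ->
  exists U V : set T, [/\ open U, open V, U x, V y & U `&` V = set0].
Proof.
rewrite open_hausdorff => hT /eqP /hT [[U V] /= [/set_mem Ux /set_mem Vy] [oU oV /eqP UV]].
by exists U, V.
Qed.

(** * Analytic sets and Lusin separation *)

Section Analytic.
Implicit Types a b : nat -> nat.

Definition agree (n : nat) a b := forall i, (i < n)%N -> a i = b i.

Lemma agree_le m n a b : (m <= n)%N -> agree n a b -> agree m a b.
Proof. by move=> mn H i im; apply: H; apply: leq_trans mn. Qed.

(** The topology of the Baire space enters only through agreement on initial segments: this is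
    closedness, and [seq_continuous] is continuity on a subset. *)
Definition seq_closed (C : set (nat -> nat)) :=
  forall a, (forall n, exists2 b, C b & agree n a b) -> C a.

Definition seq_continuous (Y : topologicalType) (C : set (nat -> nat))
    (f : (nat -> nat) -> Y) :=
  forall a, C a -> forall O, open O -> O (f a) ->
  exists n, forall b, C b -> agree n a b -> O (f b).

(* [Y] is only ever nonempty here: for empty [Y] no [f] exists. *)
Definition analytic (Y : topologicalType) (A : set Y) :=
  exists (C : set (nat -> nat)) (f : (nat -> nat) -> Y),
    [/\ seq_closed C, seq_continuous C f & A = f @` C].

Lemma analytic_image (Y Z : topologicalType) (h : Y -> Z) (A : set Y) :
  continuous h -> analytic A -> analytic (h @` A).
Proof.
move=> /continuousP ch [C [f [cC cf ->]]]; exists C, (h \o f); split=> //.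
- by move=> a Ca O oO Oa; apply: (cf a Ca _ (ch _ oO)).
- by rewrite image_comp.
Qed.

(** The first digit of a code selects the set [F n], the remaining digits are a code of a point in
    it. *)
Lemma analytic_bigcup (Y : topologicalType) (F : nat -> set Y) :
  (forall n, analytic (F n)) -> analytic (\bigcup_n F n).
Proof.
move=> /choice[C /choice[f H]].
pose tl a : nat -> nat := fun n => a n.+1.
exists [set a | C (a 0) (tl a)], (fun a => f (a 0) (tl a)); split.
- move=> a Ha /=; have [cC _ _] := H (a 0); apply: cC => n.
  have [b Cb ab] := Ha n.+1; exists (tl b); last by move=> i ? /=; apply: ab.
  by rewrite (ab 0).
- move=> a /= Ca O oO Oa; have [_ cf _] := H (a 0).
  have [n Hn] := cf _ Ca _ oO Oa; exists n.+1 => b Cb ab.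
  rewrite -(ab 0)//; apply: Hn; first by rewrite (ab 0).
  by move=> i ? /=; apply: ab.
- apply/seteqP; split=> [y [n _]|y [a /= Ca <-]].
    have [_ _ ->] := H n => -[a Ca <-].
    by exists (fun k => if k is k'.+1 then a k' else n).
  by exists (a 0) => //; have [_ _ ->] := H (a 0); exists (tl a).
Qed.

(** Through a pairing of indices, one sequence encodes countably many sequences; [agree_unmerge]
    below is the continuity of the decoding. *)
Definition pair_code (i j : nat) : nat := pickle (i, j).
Definition unmerge a (i : nat) : nat -> nat := fun j => a (pair_code i j).
Definition merge (s : nat -> nat -> nat) : nat -> nat :=
  fun k => if unpickle k is Some ij then s ij.1 ij.2 else 0.

Lemma unmergeK s i : unmerge (merge s) i = s i.
Proof. by apply/funext => j; rewrite /unmerge /merge pickleK. Qed.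

Lemma agree_unmerge i n : exists N, forall a b,
  agree N a b -> agree n (unmerge a i) (unmerge b i).
Proof.
exists (\max_(j < n) (pair_code i j).+1) => a b H j jn; apply: H.
exact: (leq_bigmax (Ordinal jn)).
Qed.

(** A code is a merged family of codes, one for each [F i], all with the same image. The equality of
    images is a closed condition because [Y] is Hausdorff. *)
Lemma analytic_bigcap (Y : topologicalType) (F : nat -> set Y) :
  hausdorff_space Y -> (forall n, analytic (F n)) -> analytic (\bigcap_n F n).
Proof.
move=> hY /choice[C /choice[f H]].
exists [set a | forall i, C i (unmerge a i) /\ f i (unmerge a i) = f 0 (unmerge a 0)],
  (fun a => f 0 (unmerge a 0)); split.
- move=> a Ha.
  have Ca i : C i (unmerge a i).
    have [cC _ _] := H i; apply: cC => n; have [N HN] := agree_unmerge i n.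
    by have [b /(_ i)[Cb _] ab] := Ha N; exists (unmerge b i) => //; apply: HN.
  move=> i; split=> //; apply: contrapT => /(hausdorff_separate hY)
    [U [V [oU oV Ua Va UV]]].
  have [_ /(_ _ (Ca i) _ oU Ua) [n Hn] _] := H i.
  have [_ /(_ _ (Ca 0) _ oV Va) [m Hm] _] := H 0.
  have [N HN] := agree_unmerge i n; have [M HM] := agree_unmerge 0 m.
  have [b Hb ab] := Ha (maxn N M).
  have Ub : U (f i (unmerge b i)).
    by apply: Hn; [case: (Hb i)|apply/HN/agree_le/ab/leq_maxl].
  have Vb : V (f i (unmerge b i)).
    rewrite (proj2 (Hb i)).
    by apply: Hm; [case: (Hb 0)|apply/HM/agree_le/ab/leq_maxr].
  by have : (U `&` V) (f i (unmerge b i)) by []; rewrite UV.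
- move=> a Ca O oO Oa; have [_ cf _] := H 0.
  have [n Hn] := cf _ (proj1 (Ca 0)) _ oO Oa.
  have [N HN] := agree_unmerge 0 n; exists N => b Cb ab; apply: Hn; last exact: HN.
  by case: (Cb 0).
- apply/seteqP; split=> [y Fy|y [a Ca <-] i _].
    have /choice[s Hs] : forall i, exists a, C i a /\ f i a = y.
      move=> i; have [_ _ Fi] := H i; move: (Fy i I); rewrite Fi => -[a Ca <-].
      by exists a.
    exists (merge s) => [i|]; rewrite ?unmergeK; last by case: (Hs 0).
    by rewrite !(proj2 (Hs _)); split=> //; case: (Hs i).
  by have [_ _ ->] := H i; exists (unmerge a i); case: (Ca i).
Qed.

Lemma analytic_setU (Y : topologicalType) (A B : set Y) :
  analytic A -> analytic B -> analytic (A `|` B).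
Proof.
move=> aA aB; rewrite (_ : A `|` B = \bigcup_n (if n is 0 then A else B)).
  by apply: analytic_bigcup; case.
apply/seteqP; split=> [x [?|?]|x [[|n] _ ?]]; [by exists 0|by exists 1|by left|by right].
Qed.

Lemma analytic_setX (Y Z : topologicalType) (A : set Y) (B : set Z) :
  analytic A -> analytic B -> analytic (A `*` B).
Proof.
move=> [C [f [cC cf ->]]] [D [g [cD cg ->]]].
exists [set a | C (unmerge a 0) /\ D (unmerge a 1)],
  (fun a => (f (unmerge a 0), g (unmerge a 1))); split.
- move=> a Ha; split.
    apply: cC => n; have [N HN] := agree_unmerge 0 n.
    by have [b [Cb _] ab] := Ha N; exists (unmerge b 0) => //; apply: HN.
  apply: cD => n; have [N HN] := agree_unmerge 1 n.
  by have [b [_ Cb] ab] := Ha N; exists (unmerge b 1) => //; apply: HN.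
- move=> a [Ca Da] O oO Oa.
  have /= : nbhs (f (unmerge a 0), g (unmerge a 1)) O by apply: open_nbhs_nbhs.
  move=> [[U V] /= [nU nV] UVO].
  move: nU nV; rewrite !nbhsE => -[U' [oU' U'f] U'U] [V' [oV' V'f] V'V].
  have [n Hn] := cf _ Ca _ oU' U'f; have [m Hm] := cg _ Da _ oV' V'f.
  have [N HN] := agree_unmerge 0 n; have [M HM] := agree_unmerge 1 m.
  exists (maxn N M) => b [Cb Db] ab; apply: UVO; split=> /=.
    by apply/U'U/Hn => //; apply/HN/agree_le/ab/leq_maxl.
  by apply/V'V/Hm => //; apply/HM/agree_le/ab/leq_maxr.
- apply/seteqP; split=> [[y z] /= [[a Ca <-] [b Db <-]]|_ [a [Ca Da] <-]].
    by exists (merge (fun i => if i is 0 then a else b)); rewrite /= !unmergeK.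
  by split; [exists (unmerge a 0)|exists (unmerge a 1)].
Qed.

(** If no Borel set separates the images, inseparability passes from a pair of prefixes to some
    one-digit extension of both. The two branches obtained have distinct images, and disjoint
    neighbourhoods of these separate the images of long prefixes after all. *)
Lemma lusin_separation (Y : topologicalType) (A B : set Y) :
  hausdorff_space Y -> analytic A -> analytic B -> A `&` B = set0 ->
  exists2 S, borel S & A `<=` S /\ B `&` S = set0.
Proof.
move=> hY [C [f [cC cf ->]]] [D [g [cD cg ->]]] AB0.
pose pre (s : seq nat) a := forall i, (i < size s)%N -> a i = nth 0 s i.
pose sep (s t : seq nat) := exists2 S, borel S &
  (forall a, C a -> pre s a -> S (f a)) /\ (forall b, D b -> pre t b -> ~ S (g b)).
have pre_rcons s a : pre s a -> pre (rcons s (a (size s))) a.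
  move=> sa i; rewrite size_rcons ltnS leq_eqVlt nth_rcons => /orP[/eqP ->|isz].
    by rewrite ltnn eqxx.
  by rewrite isz; apply: sa.
have step s t : ~ sep s t -> exists kl : nat * nat, ~ sep (rcons s kl.1) (rcons t kl.2).
  move=> ns; apply: contrapT => H; apply: ns.
  have /choice[S HS] : forall kl : nat * nat, exists S, borel S /\
    ((forall a, C a -> pre (rcons s kl.1) a -> S (f a)) /\
     (forall b, D b -> pre (rcons t kl.2) b -> ~ S (g b))).
    move=> kl; apply: contrapT => nS; apply: H; exists kl => -[S bS ?].
    by apply: nS; exists S.
  (* Separating sets for all pairs of one-digit extensions combine into one for the pair [s],
     [t]. *)
  exists [set y | exists k, forall l, S (k, l) y].
    by apply: borel_ex => k; apply: borel_all => l; case: (HS (k, l)).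
  split=> [a Ca sa|b Db tb].
    exists (a (size s)) => l; have [_ [+ _]] := HS (a (size s), l).
    by apply=> //; apply: pre_rcons.
  move=> [k /(_ (b (size t)))].
  by have [_ [_]] := HS (k, b (size t)); apply=> //; apply: pre_rcons.
apply: contrapT => nS.
have ns0 : ~ sep [::] [::].
  move=> [S bS [H1 H2]]; apply: nS; exists S => //; split.
    by move=> _ [a Ca <-]; apply: H1.
  by rewrite -subset0 => _ [[b Db <-]]; apply: H2.
pose nx (st : seq nat * seq nat) : nat * nat :=
  if pselect (~ sep st.1 st.2) is left h then sval (cid (step _ _ h)) else (0, 0).
have nxP st : ~ sep st.1 st.2 -> ~ sep (rcons st.1 (nx st).1) (rcons st.2 (nx st).2).
  by rewrite /nx; case: pselect => // h _; case: cid.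
pose st := fix st n := if n is n'.+1
  then (rcons (st n').1 (nx (st n')).1, rcons (st n').2 (nx (st n')).2)
  else ([::], [::]).
have stP n : ~ sep (st n).1 (st n).2 by elim: n => [|n IH] //; apply: nxP.
have sz1 n : size (st n).1 = n by elim: n => //= n IH; rewrite size_rcons IH.
have sz2 n : size (st n).2 = n by elim: n => //= n IH; rewrite size_rcons IH.
pose a n := (nx (st n)).1; pose b n := (nx (st n)).2.
have nth1 n i : (i < n)%N -> nth 0 (st n).1 i = a i.
  elim: n => // k IH; rewrite ltnS leq_eqVlt /= nth_rcons sz1 => /orP[/eqP ->|h].
    by rewrite ltnn eqxx.
  by rewrite h IH.
have nth2 n i : (i < n)%N -> nth 0 (st n).2 i = b i.
  elim: n => // k IH; rewrite ltnS leq_eqVlt /= nth_rcons sz2 => /orP[/eqP ->|h].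
    by rewrite ltnn eqxx.
  by rewrite h IH.
(* If no member of [C] extended the prefix, the corresponding image would be empty and [set0] would
   separate; dually [setT] for [D]. *)
have Ca : C a.
  apply: cC => n; apply: contrapT => nC; apply: (stP n).
  exists set0; [exact: borel_set0|split=> [c Cc pc|c _ _ //]].
  by apply: nC; exists c => // i ni; rewrite pc ?sz1// nth1.
have Db : D b.
  apply: cD => n; apply: contrapT => nD; apply: (stP n).
  exists setT; [by apply: borel_open; apply: openT|split=> // c Dc pc].
  by exfalso; apply: nD; exists c => // i ni; rewrite pc ?sz2// nth2.
have fg : f a <> g b.
  move=> fg; have : (f @` C `&` g @` D) (f a).
    by split; [exists a|rewrite fg; exists b].
  by rewrite AB0.
have [U [V [oU oV Ua Vb UV]]] := hausdorff_separate hY fg.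
have [n Hn] := cf _ Ca _ oU Ua; have [m Hm] := cg _ Db _ oV Vb.
apply: (stP (maxn n m)); exists U; [exact: borel_open|split=> [c Cc pc|c Cc pc Uc]].
  apply: Hn => // i im; have im' : (i < maxn n m)%N by rewrite leq_max im.
  by rewrite pc ?sz1// nth1.
have Vc : V (g c).
  apply: Hm => // i im; have im' : (i < maxn n m)%N by rewrite leq_max im orbT.
  by rewrite pc ?sz2// nth2.
by have : (U `&` V) (g c) by []; rewrite UV.
Qed.

Lemma suslin (Y : topologicalType) (A : set Y) :
  hausdorff_space Y -> analytic A -> analytic (~` A) -> borel A.
Proof.
move=> hY aA aC; have [|S bS [AS CS]] := lusin_separation hY aA aC.
  exact: setICr.
suff -> : A = S by [].
apply/seteqP; split=> // x Sx; apply: contrapT => nA.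
by have : (~` A `&` S) x by []; rewrite CS.
Qed.

End Analytic.

(** * Polish spaces *)

(** A complete compatible metric stated on [X] itself, so that the space [M] in [polish] and the
    homeomorphism can be forgotten. *)
Record complete_dist (R : realType) (X : topologicalType) (dist : X -> X -> R) : Prop := {
  cd_refl : forall x, dist x x = 0%R;
  cd_eq : forall x y, dist x y = 0%R -> x = y;
  cd_sym : forall x y, dist x y = dist y x;
  cd_triangle : forall x y z, (dist x z <= dist x y + dist y z)%R;
  cd_open : forall x (e : R), open [set y | dist x y < e]%R;
  cd_nbhs : forall V x, open V -> V x ->
    exists2 e : R, (0 < e)%R & forall y, (dist x y < e)%R -> V y;
  cd_complete : forall u : nat -> X,
    (forall e : R, (0 < e)%R -> exists N, forall m n, (N <= m)%N -> (N <= n)%N ->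
      (dist (u m) (u n) < e)%R) ->
    exists l, forall e : R, (0 < e)%R -> exists N, forall n, (N <= n)%N ->
      (dist (u n) l < e)%R }.

Lemma polish_complete_dist (R : realType) (X : topologicalType) :
  polish R X -> exists dist : X -> X -> R, complete_dist dist.
Proof.
move=> [_ [M [cM [h [k [hk kh ch ck]]]]]].
exists (fun x y => mdist (h x) (h y)); split.
- by move=> x; rewrite mdistxx.
- by move=> x y /mdist_positivity hxy; rewrite -(hk x) hxy hk.
- by move=> x y; rewrite metric_sym.
- by move=> x y z; apply: metric_triangle.
- move=> x e; have -> : [set y | mdist (h x) (h y) < e]%R = h @^-1` ball (h x) e.
    by rewrite ballEmdist.
  move/continuousP: ch; apply; have [e0|e0] := ltP 0%R e.
    rewrite openE => y; rewrite ballEmdist /= => xy; rewrite /interior.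
    have e1 : (0 < e - mdist (h x) y)%R by rewrite subr_gt0.
    apply: filterS (nbhsx_ballx y _ e1) => z; rewrite !ballEmdist /= => yz.
    by rewrite (le_lt_trans (metric_triangle _ y _))// -ltrBrDl.
  rewrite (_ : ball _ _ = set0); first exact: open0.
  rewrite ballEmdist; apply/seteqP; split=> // y /= xy.
  by have := lt_le_trans xy e0; rewrite ltNge mdist_ge0.
- move=> V x oV Vx; have oV' : open (k @^-1` V) by move/continuousP: ck; apply.
  have : nbhs (h x) (k @^-1` V) by apply: open_nbhs_nbhs; split=> //=; rewrite hk.
  move=> /nbhs_ballP[e /= e0 eV]; exists e => // y xy.
  by rewrite -(hk y); apply: eV; rewrite ballEmdist.
- move=> u cu; have [|l ul] := cM (h \o u).
    apply: cauchy_exP => e e0; have [N HN] := cu e e0.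
    by exists (h (u N)); exists N => // n /= Nn; rewrite ballEmdist /=; apply: HN.
  exists (k l) => e e0; have : nbhs l (ball l e) by exact: nbhsx_ballx.
  move=> /ul[N _ HN]; exists N => n Nn; have := HN n Nn.
  by rewrite /= ballEmdist /= kh metric_sym.
Qed.

Lemma fst_continuous (S T : topologicalType) : continuous (@fst S T).
Proof. by move=> x; exact: cvg_fst. Qed.

Lemma snd_continuous (S T : topologicalType) : continuous (@snd S T).
Proof. by move=> x; exact: cvg_snd. Qed.

Section PolishSpace.
Variables (R : realType) (X : topologicalType) (dist : X -> X -> R).
Hypotheses (cd : complete_dist dist) (sX : separable X) (x0 : X).

Definition radius (n : nat) : R := (n.+1%:R^-1)%R.

Lemma radius_gt0 n : (0 < radius n)%R.
Proof. by rewrite /radius invr_gt0 ltr0n. Qed.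

Lemma radius_small (e : R) : (0 < e)%R -> exists n, forall m, (n <= m)%N -> (radius m < e)%R.
Proof.
move=> e0; exists (Num.truncn e^-1) => m nm; rewrite /radius -[e]invrK ltf_pV2 ?posrE ?invr_gt0 ?ltr0n//.
have := truncnS_gt e^-1; move=> /lt_le_trans; apply.
by rewrite ler_nat ltnS.
Qed.

Lemma dist_hausdorff : hausdorff_space X.
Proof.
rewrite open_hausdorff => x y xy.
pose e := (dist x y / 2)%R.
have d0 z w : (0 <= dist z w)%R.
  have := cd_triangle cd z w z; rewrite (cd_refl cd) (cd_sym cd w z); lra.
have e0 : (0 < e)%R.
  rewrite divr_gt0// lt_def d0 andbT; apply: contra_neq xy.
  exact: cd_eq cd _ _.
exists ([set z | dist x z < e]%R, [set z | dist y z < e]%R) => /=.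
  by split; apply/mem_set => /=; rewrite (cd_refl cd).
split; [exact: cd_open|exact: cd_open|].
apply/eqP/seteqP; split=> // z [/= xz yz].
have := cd_triangle cd x z y; rewrite (cd_sym cd z y) /e in xz yz *; lra.
Qed.

Lemma dense_sequence : exists q : nat -> X,
  forall x (e : R), (0 < e)%R -> exists n, (dist (q n) x < e)%R.
Proof.
have [D /countable_injP[f fi] dD] := sX.
(* An injection of the countable dense set into the natural numbers is inverted; numbers outside its
   image are sent to the default [x0]. *)
exists (fun n => if pselect (exists2 x, D x & f x = n) is left h then s2val (cid2 h) else x0).
move=> x e e0; have [] := dD [set y | dist x y < e]%R.
- by exists x; rewrite /= (cd_refl cd).
- exact: cd_open.
- move=> y [/= xy Dy]; exists (f y); case: pselect => [h|]; last by case; exists y.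
  case: cid2 => z Dz fzy /=; rewrite (fi z y) ?inE// (cd_sym cd) //.
Qed.

Definition open_base (U : nat -> set X) :=
  (forall n, open (U n)) /\
  (forall V x, open V -> V x -> exists n, U n x /\ U n `<=` V).

Lemma polish_base : exists U, open_base U.
Proof.
have [q Hq] := dense_sequence.
pose U n := if unpickle n is Some ij then [set y | dist (q ij.1) y < radius ij.2]%R else set0.
exists U; split=> [n|V x oV Vx].
  by rewrite /U; case: unpickle => [ij|]; [exact: cd_open|exact: open0].
have [e e0 He] := cd_nbhs cd oV Vx.
have e2 : (0 < e / 2)%R by rewrite divr_gt0.
have [m /(_ m (leqnn m)) Hm] := radius_small e2.
have [n Hn] := Hq x _ (radius_gt0 m).
exists (pickle (n, m)); rewrite /U pickleK /=; split=> // y /= qy; apply: He.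
have := cd_triangle cd x (q n) y; rewrite (cd_sym cd x (q n)); lra.
Qed.

(* A point of [A] is coded by the indices of points of a dense sequence lying
   within [1/(n+1)] of it. *)
Lemma analytic_closed (A : set X) : closed A -> analytic A.
Proof.
move=> cA; have [q Hq] := dense_sequence.
pose P (a : nat -> nat) y := A y /\ forall n, (dist (q (a n)) y <= radius n)%R.
pose f a := if pselect (exists y, P a y) is left h then sval (cid h) else x0.
have fP a : (exists y, P a y) -> P a (f a).
  by rewrite /f; case: pselect => // h _; case: cid.
have near_eq n a b y z : agree n.+1 a b -> P a y -> P b z -> (dist y z <= 2 * radius n)%R.
  move=> ab [_ /(_ n) ay] [_ /(_ n) bz]; rewrite -(ab n) // in bz.
  have := cd_triangle cd y (q (a n)) z; rewrite (cd_sym cd y (q (a n))); lra.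
have P_inj a y z : P a y -> P a z -> y = z.
  move=> Py Pz; apply: (cd_eq cd); apply/eqP; rewrite eq_le; apply/andP; split.
    apply/ler_addgt0Pl => e e0; rewrite addr0.
    have e2 : (0 < e / 2)%R by rewrite divr_gt0.
    have [n /(_ n (leqnn n)) Hn] := radius_small e2.
    have := @near_eq n a a y z (fun _ _ => erefl) Py Pz; lra.
  have := cd_triangle cd y z y; rewrite (cd_refl cd) (cd_sym cd z y); lra.
exists [set a | exists y, P a y], f; split.
- move=> a Ha.
  have /choice[b Hb] : forall n, exists b, (exists y, P b y) /\ agree n a b.
    by move=> n; have [b ? ?] := Ha n; exists b.
  (* Agreement up to [n.+1] includes the digit [n], so [y n] is within [radius m] of [q (a m)] for
     all [m <= n]; hence [y] is Cauchy and its limit is coded by [a]. *)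
  pose y n := f (b n.+1).
  have yP n : P (b n.+1) (y n) by apply/fP; case: (Hb n.+1).
  have yn m n : (m <= n)%N -> (dist (q (a m)) (y n) <= radius m)%R.
    move=> mn; have [_ /(_ m)] := yP n.
    by have [_ /(_ m) ->] := Hb n.+1.
  have [e e0|l Hl] := cd_complete cd (u := y).
    have e2 : (0 < e / 2)%R by rewrite divr_gt0.
    have [N /(_ N (leqnn N)) HN] := radius_small e2; exists N => m n Nm Nn.
    have := yn N m Nm; have := yn N n Nn.
    have := cd_triangle cd (y m) (q (a N)) (y n); rewrite (cd_sym cd (y m) (q (a N))); lra.
  exists l; split.
    apply: contrapT => nAl; have [e e0 He] := cd_nbhs cd (closed_openC cA) nAl.
    have [N HN] := Hl e e0; apply: (He (y N)); last by case: (yP N).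
    by rewrite (cd_sym cd); apply: HN.
  move=> n; apply/ler_addgt0Pl => e e0; have [N HN] := Hl e e0.
  have := HN (maxn n N) (leq_maxr _ _); have := yn n (maxn n N) (leq_maxl _ _).
  have := cd_triangle cd (q (a n)) (y (maxn n N)) l; lra.
- move=> a Ca O oO Oa; have [e e0 He] := cd_nbhs cd oO Oa.
  have e2 : (0 < e / 2)%R by rewrite divr_gt0.
  have [n /(_ n (leqnn n)) Hn] := radius_small e2; exists n.+1 => b Cb ab.
  apply: He; have := near_eq n a b _ _ ab (fP _ Ca) (fP _ Cb); lra.
- apply/seteqP; split=> [y Ay|_ [a Ca <-]]; last by case: (fP a Ca).
  have /choice[a Ha] : forall n, exists k, (dist (q k) y < radius n)%R.
    by move=> n; apply/Hq/radius_gt0.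
  have Pa : P a y by split=> // n; apply/ltW.
  by exists a; [exists y|apply: (P_inj a) => //; apply: fP; exists y].
Qed.

(** An open set is a countable union of closed ones: the points at distance at least [radius n] from
    the complement. *)
Lemma analytic_open (A : set X) : open A -> analytic A.
Proof.
move=> oA.
pose F n := [set y | forall z, (dist y z < radius n)%R -> A z].
rewrite (_ : A = \bigcup_n F n).
  apply: analytic_bigcup => n; apply: analytic_closed.
  suff : open (~` F n) by move=> /open_closedC; rewrite setCK.
  rewrite (_ : ~` F n = \bigcup_(z in ~` A) [set y | dist z y < radius n]%R).
    by apply: bigcup_open => z _; apply: cd_open.
  apply/seteqP; split=> [y /existsNP[z /not_implyP[yz nz]]|y [z nz /= zy] H].
    by exists z => //=; rewrite (cd_sym cd).
  by apply/nz/H; rewrite (cd_sym cd).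
apply/seteqP; split=> [x Ax|x [n _ H]]; last by apply: H; rewrite (cd_refl cd) radius_gt0.
have [e e0 He] := cd_nbhs cd oA Ax; have [n /(_ n (leqnn n)) Hn] := radius_small e0.
by exists n => // z xz; apply/He/(lt_trans xz).
Qed.

Lemma prod_hausdorff : hausdorff_space (X * X)%type.
Proof.
rewrite open_hausdorff => -[x1 x2] [y1 y2] xy.
have sep (h : X * X -> X) : continuous h -> h (x1, x2) <> h (y1, y2) ->
    exists2 AB : set (X * X) * set (X * X), (x1, x2) \in AB.1 /\ (y1, y2) \in AB.2 &
      [/\ open AB.1, open AB.2 & AB.1 `&` AB.2 == set0].
  move=> /continuousP ch hn.
  have [U [V [oU oV Ux Vy UV]]] := hausdorff_separate dist_hausdorff hn.
  exists (h @^-1` U, h @^-1` V) => /=; first by split; apply/mem_set.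
  by split; [exact: ch|exact: ch|rewrite -preimage_setI UV preimage_set0].
have [e1|n1] := pselect (x1 = y1); last by apply: (sep fst) => //; apply: fst_continuous.
apply: (sep snd); first exact: snd_continuous.
by move=> /= e2; move: xy; rewrite e1 e2 eqxx.
Qed.

(** Induction over Borel sets needs the stronger claim that the set and its complement are both
    analytic. An open set is a countable union of basic boxes contained in it. *)
Lemma borel_analytic2 (A : set (X * X)) : borel A -> analytic A.
Proof.
suff H : forall A : set (X * X), borel A -> analytic A /\ analytic (~` A) by move=> /H[].
have aT : analytic (@setT X) by apply: analytic_open; exact: openT.
have hX := prod_hausdorff.
have [U [oU bU]] := polish_base.
apply: borel_ind => [ O oO|B [aB aCB]|F HF].
- pose F n := if unpickle n is Some ij then
    (if pselect (U ij.1 `*` U ij.2 `<=` O) is left _ then U ij.1 `*` U ij.2 else set0)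
    else (set0 : set (X * X)).
  have -> : O = \bigcup_n F n.
    apply/seteqP; split=> [[x y] Oxy|xy [n _]]; last first.
      by rewrite /F; case: unpickle => // -[i j] /=; case: pselect => // H /H.
    have : nbhs (x, y) O by apply: open_nbhs_nbhs.
    move=> [[V W] /= [nV nW] VWO].
    move: nV nW; rewrite !nbhsE => -[V' [oV' V'x] V'V] [W' [oW' W'y] W'W].
    have [i [Ui Vi]] := bU _ _ oV' V'x; have [j [Uj Wj]] := bU _ _ oW' W'y.
    exists (pickle (i, j)) => //; rewrite /F pickleK /=; case: pselect => //.
    by case=> -[z w] /= [/Vi/V'V Vz /Wj/W'W Ww]; apply: VWO.
  have a0 : analytic (@set0 (X * X)).
    rewrite (_ : set0 = (@setT X) `*` (@set0 X)); last by apply/seteqP; split=> // -[? ?] [].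
    apply: analytic_setX => //.
    by apply: analytic_closed; exact: closed0.
  have aST : analytic (@setT (X * X)) by rewrite -setXTT; apply: analytic_setX.
  split; first apply: analytic_bigcup => n.
    rewrite /F; case: unpickle => // -[i j] /=; case: pselect => // _.
    by apply: analytic_setX; apply: analytic_open.
  rewrite setC_bigcup; apply: analytic_bigcap => // n.
  rewrite /F; case: unpickle => [[i j]|] /=; last by rewrite setC0.
  case: pselect => [_|]; last by rewrite setC0.
  have aC k : analytic (~` U k) by apply/analytic_closed/open_closedC.
  rewrite (_ : ~` _ = (~` U i `*` setT) `|` (setT `*` ~` U j)).
    by apply: analytic_setU; apply: analytic_setX.
  apply/seteqP; split=> -[x y] /=; last by case=> -[H1 H2] [].
  move=> /not_andP[]; [by left|by right].
- by rewrite setCK.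
- split; first by apply: analytic_bigcup => n; case: (HF n).
  by rewrite setC_bigcup; apply: analytic_bigcap => // n; case: (HF n).
Qed.

Lemma analytic_proj (E : set (X * X)) (B : set X) : borel E -> borel B ->
  analytic [set x | exists2 y, E (x, y) & B y].
Proof.
move=> bE bB.
rewrite (_ : [set x | _] = fst @` (E `&` snd @^-1` B)).
  apply: analytic_image; first exact: fst_continuous.
  apply: borel_analytic2; apply: borel_and => //.
  exact: borel_preimage (@snd_continuous X X) bB.
apply/seteqP; split=> [x [y Exy By]|_ [[x y] [/= Exy By] <-]]; last by exists y.
by exists (x, y).
Qed.

End PolishSpace.

(** * Baire category and Borel neighbour functions *)

Section BaireCategory.
Context {X : topologicalType}.
Implicit Types A B O : set X.

Lemma nowhere_dense_sub A B : A `<=` B -> nowhere_dense B -> nowhere_dense A.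
Proof.
move=> AB; rewrite /nowhere_dense => B0; rewrite -subset0 -B0.
exact/interiorS/closureS.
Qed.

Lemma meagre_sub A B : A `<=` B -> meagre B -> meagre A.
Proof.
move=> AB [F nF BF]; exists (fun n => F n `&` A) => [n|].
  exact: nowhere_dense_sub (@subIsetl _ _ _) (nF n).
by rewrite -setI_bigcupl -BF setIidr.
Qed.

Lemma meagre_bigcup (F : nat -> set X) :
  (forall n, meagre (F n)) -> meagre (\bigcup_n F n).
Proof.
move=> mF.
have /choice[G HG] : forall n, exists G : nat -> set X,
    (forall k, nowhere_dense (G k)) /\ F n = \bigcup_k G k.
  by move=> n; have [G ? ?] := mF n; exists G.
exists (fun k => if unpickle k is Some ij then G ij.1 ij.2 else set0).
  move=> k; case: unpickle => [[i j]|] /=; first by case: (HG i).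
  by rewrite /nowhere_dense closure0 interior0.
apply/seteqP; split=> x.
  move=> [n _]; have [_ ->] := HG n => -[k _ Gx].
  by exists (pickle (n, k)) => //; rewrite pickleK.
move=> [k _]; case: unpickle => // -[i j] /= Gx.
by exists i => //; have [_ ->] := HG i; exists j.
Qed.

Lemma meagre_ex (I : countType) (P : I -> X -> Prop) :
  (forall i, meagre [set x | P i x]) -> meagre [set x | exists i, P i x].
Proof.
move=> mP; pose F n := if unpickle n is Some i then [set x | P i x] else set0.
suff -> : [set x | exists i, P i x] = \bigcup_n F n.
  apply: meagre_bigcup => n; rewrite /F; case: unpickle => [i|] //.
  exists (fun=> set0); last by rewrite bigcup0.
  by rewrite /nowhere_dense closure0 interior0.
apply/seteqP; split=> [x [i Pix]|x [n _]].
  by exists (pickle i) => //; rewrite /F pickleK.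
by rewrite /F; case: unpickle => // i Pix; exists i.
Qed.

Lemma meagreU A B : meagre A -> meagre B -> meagre (A `|` B).
Proof.
move=> mA mB; rewrite (_ : A `|` B = [set x | exists b : bool, if b then A x else B x]).
  by apply: meagre_ex; case.
apply/seteqP; split=> [x [?|?]|x [[] ?]]; [by exists true|by exists false|by left|by right].
Qed.

Lemma nowhere_dense_meagre A : nowhere_dense A -> meagre A.
Proof.
move=> nA; exists (fun=> A) => //; apply/seteqP; split=> [x Ax|x [] //].
by exists 0.
Qed.

(** For a complement, the open set [O] is replaced by the complement of its closure; the error grows
    by the boundary [closure O \ O], which is nowhere dense. *)
Lemma baire_property A : borel A ->
  exists2 O, open O & meagre (A `\` O `|` O `\` A).
Proof.
move: A; apply: borel_ind => [ O oO|B [ O oO mO]|F HF].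
- by exists O => //; rewrite setDv setU0; apply: nowhere_dense_meagre;
    rewrite /nowhere_dense closure0 interior0.
- exists (~` closure O); first exact/closed_openC/closed_closure.
  apply: (@meagre_sub _ ((B `\` O `|` O `\` B) `|` (closure O `\` O))).
    move=> x [[nB /contrapT cO]|[ncO /contrapT Bx]].
      by have [Ox|nO] := pselect (O x); [left; right|right].
    by left; left; split=> // Ox; apply/ncO/subset_closure.
  apply: meagreU => //; apply: nowhere_dense_meagre; rewrite /nowhere_dense.
  rewrite -subset0 => x; rewrite /interior => ncl.
  have clO : closed (closure O `\` O).
    by rewrite setDE; apply: closedI; [exact: closed_closure|exact: open_closedC].
  have : nbhs x (closure O `\` O) by move: ncl; rewrite -(closure_id _).1.
  move=> nx; have [clx _] := nbhs_singleton nx.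
  by have [y [Oy [_ nOy]]] := clx _ nx.
- have /choice[V HV] : forall n, exists O, open O /\ meagre (F n `\` O `|` O `\` F n).
    by move=> n; have [ O ? ?] := HF n; exists O.
  exists (\bigcup_n V n); first by apply: bigcup_open => n _; case: (HV n).
  apply: (@meagre_sub _ (\bigcup_n (F n `\` V n `|` V n `\` F n))); last first.
    by apply: meagre_bigcup => n; case: (HV n).
  move=> x [[[n _ Fx] nV]|[[n _ Vx] nF]]; exists n => //.
    by left; split=> // Vx; apply: nV; exists n.
  by right; split=> // Fx; apply: nF; exists n.
Qed.

(** If [P] is not comeagre, its complement agrees up to a meagre set with a nonmeagre open set. This
    contains a nonmeagre basic set, on which [P] is meagre. *)
Lemma comeagre_of_base (U : nat -> set X) (P : set X) : open_base U -> borel P ->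
  (forall j, ~ meagre (U j) -> ~ meagre (U j `&` P)) -> comeagre P.
Proof.
move=> [oU bU] bP HP; apply: contrapT => nm; rewrite /comeagre in nm.
have [ O oO mO] := baire_property (borelC bP).
have nO : ~ meagre O.
  move=> m; apply: nm; apply: meagre_sub (meagreU m mO) => x nPx.
  by have [Ox|nOx] := pselect (O x); [left|right; left].
have [j [jO nj]] : exists j, U j `<=` O /\ ~ meagre (U j).
  apply: contrapT => H; apply: nO.
  apply: (@meagre_sub _ [set x | exists j, (U j `<=` O) /\ U j x]).
    by move=> x Ox; have [j [? ?]] := bU _ _ oO Ox; exists j.
  apply: meagre_ex => j; have [jO|njO] := pselect (U j `<=` O); last first.
    by apply: nowhere_dense_meagre; rewrite /nowhere_dense
      (_ : [set x | _] = set0) ?closure0 ?interior0//; apply/seteqP; split=> // x [].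
  apply: (@meagre_sub _ (U j)); first by move=> x [].
  by apply: contrapT => nj; apply: H; exists j.
apply: (HP j nj); apply: meagre_sub mO => x [Ux Px]; right; split; first exact: jO.
by apply.
Qed.

End BaireCategory.

(** * Borel enumeration of the neighbours of a vertex *)

Section NeighbourFunctions.
Variables (R : realType) (X : topologicalType) (dist : X -> X -> R).
Hypotheses (cd : complete_dist dist) (sX : separable X) (x0 : X).
Variables (d : nat) (E : set (X * X)).
Hypotheses (bE : borel E) (rE : regular_graph d E).

Let hX : hausdorff_space X := dist_hausdorff cd.

Lemma nbr_enum x : exists h : 'I_d -> X, [/\ injective h,
  forall i, E (x, h i) & forall y, E (x, y) -> exists i, h i = y].
Proof.
have /card_set_bijP[f [f1 f2 f3]] := rE x.
have /choice[h Hh] : forall i : 'I_d, exists y, E (x, y) /\ f y = i.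
  by move=> i; have [y /= Exy fy] := f3 i (ltn_ord i); exists y.
exists h; split.
- by move=> i j hij; apply: ord_inj; rewrite -(proj2 (Hh i)) hij (proj2 (Hh j)).
- by move=> i; case: (Hh i).
- move=> y Exy; have fyd : (f y < d)%N by apply: f1.
  exists (Ordinal fyd); apply: f2; rewrite ?inE /=; [by case: (Hh (Ordinal fyd))|by []|].
  by rewrite (proj2 (Hh (Ordinal fyd))).
Qed.

(** An injection of ['I_d] into a set with [d] elements is onto; this is how regularity replaces a
    universal statement about neighbours by an existential one. *)
Lemma nbr_surj x (z : 'I_d -> X) : injective z -> (forall i, E (x, z i)) ->
  forall y, E (x, y) -> exists i, z i = y.
Proof.
move=> iz Ez y Ey; have [h [ih Eh sh]] := nbr_enum x.
have /choice[k hk] : forall i, exists j, h j = z i by move=> i; apply: sh.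
have ik : injective k by move=> i j kij; apply: iz; rewrite -!hk kij.
have [j <-] := sh y Ey; have [k' _ k'k] := injF_bij ik.
by exists (k' j); rewrite -hk k'k.
Qed.

Section Cells.
Variables (U : nat -> set X) (bU : open_base U).

(** Removing the other basic sets makes the cells of one [V] disjoint, while there are only
    countably many [V]. *)
Definition cell (V : {ffun 'I_d -> nat}) (i : 'I_d) : set X :=
  [set y | U (V i) y /\ forall j, j != i -> ~ U (V j) y].

Lemma cell_inj V i j y : cell V i y -> cell V j y -> i = j.
Proof.
move=> [Ui _] [_ nU]; apply/eqP; apply: contrapT => /negP ij.
exact: nU ij Ui.
Qed.

Lemma borel_cell V i : borel (cell V i).
Proof.
apply: borel_and; first by apply: borel_open; apply: bU.1.
apply: borel_all => j; apply: borel_imp; first exact: borel_const.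
by apply: borel_not; apply: borel_open; apply: bU.1.
Qed.

Lemma cell_cover (h : 'I_d -> X) : injective h -> exists V, forall i, cell V i (h i).
Proof.
move=> ih.
have /choice[V HV] : forall i, exists n, U n (h i) /\ forall j, j != i -> ~ U n (h j).
  move=> i; pose F := [set h j | j in [set j | j != i]].
  have oF : open (~` F).
    apply: closed_openC; apply: accessible_finite_set_closed.1; first exact: hausdorff_accessible.
    by apply: finite_image; apply: finite_finset.
  have [|n [Un nF]] := bU.2 _ (h i) oF.
    by move=> [j /= /negP ji /ih ij]; apply: ji; rewrite ij.
  by exists n; split=> // j ji /nF; apply; exists j.
exists [ffun i => V i] => i; rewrite /cell /= ffunE; split; first by case: (HV i).
move=> j ji; rewrite ffunE; have [_] := HV j; apply.
by rewrite eq_sym.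
Qed.

Definition nbr_in (B : set X) : set X := [set x | exists2 y, E (x, y) & B y].

(* Both this set and its complement are analytic: that all [d] neighbours avoid
   [B] says that [d] separated neighbours lie in the complement of [B]. *)
Lemma borel_nbr_in B : borel B -> borel (nbr_in B).
Proof.
move=> bB; have anB := analytic_proj cd sX x0 bE.
apply: suslin; [exact: hX|exact: anB|].
pose G V (i : 'I_d) := nbr_in (cell V i `&` ~` B).
(* Padding by [setT] beyond [d] turns the finite intersection into one over the natural numbers. *)
pose W V n := if insub n is Some i then G V i else setT.
pose F n := if unpickle n is Some V then \bigcap_k W V k else set0.
have -> : ~` nbr_in B = \bigcup_n F n.
  apply/seteqP; split=> x.
    move=> nB; have [h [ih Eh _]] := nbr_enum x; have [V HV] := cell_cover ih.
    exists (pickle V) => //; rewrite /F pickleK => k _.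
    rewrite /W; case: insubP => // i _ _; exists (h i) => //; split=> // Bh.
    by apply: nB; exists (h i).
  move=> [n _]; rewrite /F; case: unpickle => // V HW [y Exy By].
  have /choice[z Hz] : forall i, exists y, E (x, y) /\ (cell V i `&` ~` B) y.
    by move=> i; have := HW i I; rewrite /W valK => -[z ? ?]; exists z.
  have iz : injective z.
    move=> i j zij; apply: (@cell_inj V i j (z i)); first by case: (Hz i) => _ [].
    by rewrite zij; case: (Hz j) => _ [].
  have [i zi] := nbr_surj iz (fun i => proj1 (Hz i)) Exy.
  by have [_ [_]] := Hz i; rewrite zi.
apply: analytic_bigcup => n; rewrite /F; case: unpickle => [V|]; last first.
  by apply: (analytic_closed cd) => //; exact: closed0.
apply: (analytic_bigcap hX) => k; rewrite /W; case: insubP => [i _ _|_].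
  by apply: anB; apply: borel_and; [exact: borel_cell|exact: borelC].
by apply: (analytic_open cd) => //; exact: openT.
Qed.

End Cells.

(** Each [x] selects the first [V] all of whose cells contain a neighbour of [x]. Each cell then
    contains exactly one, and [g i x] is the one in cell [i]; preimages under [g i] reduce to
    [borel_nbr_in]. *)
Lemma borel_neighbours : exists g : 'I_d -> X -> X,
  [/\ forall i A, borel A -> borel (g i @^-1` A), forall i x, E (x, g i x),
      forall x y, E (x, y) -> exists i, g i x = y & forall x, injective (g^~ x)].
Proof.
have [U bU] := polish_base cd sX x0.
pose D V x := forall i, nbr_in (cell U V i) x.
pose c (x : X) V := D V x /\ forall V', (pickle V' < pickle V)%N -> ~ D V' x.
have bD V : borel [set x | D V x].
  by apply: borel_all => i; apply: (borel_nbr_in bU); apply: (borel_cell bU).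
have bc V : borel [set x | c x V].
  apply: borel_and => //; apply: borel_all => V'; apply: borel_imp.
    exact: borel_const.
  exact: borel_not.
have ex_c x : exists V, c x V.
  have [h [ih Eh _]] := nbr_enum x; have [V0 HV0] := cell_cover bU ih.
  have ex : exists n, `[< exists2 V, pickle V = n & D V x >].
    by exists (pickle V0); apply/asboolP; exists V0 => // i; exists (h i).
  have [n /asboolP[V <- DV] min] := ex_minnP ex; exists V; split=> // V' V'V DV'.
  have /min : `[< exists2 V, pickle V = pickle V' & D V x >].
    by apply/asboolP; exists V'.
  by rewrite leqNgt V'V.
have c_uniq x V V' : c x V -> c x V' -> V = V'.
  move=> [DV mV] [DV' mV']; apply: (pcan_inj pickleK).
  by have [/mV'|/mV|] := ltngtP (pickle V) (pickle V').
have /choice[g' Hg] : forall ix : 'I_d * X, exists y,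
    exists V, [/\ c ix.2 V, E (ix.2, y) & cell U V ix.1 y].
  by case=> i x; have [V cV] := ex_c x; have [y ? ?] := cV.1 i; exists y, V.
pose g i x := g' (i, x).
have gP i x V : c x V -> cell U V i (g i x).
  by move=> cV; have [V' [cV' _]] := Hg (i, x); rewrite (c_uniq _ _ _ cV cV').
have gE i x : E (x, g i x) by have [V []] := Hg (i, x).
have gi x : injective (g^~ x).
  move=> i j /= gij; have [V cV] := ex_c x.
  by apply: (@cell_inj U V i j (g i x)); [|rewrite gij]; apply: gP.
have gs x y : E (x, y) -> exists i, g i x = y.
  by apply: nbr_surj => // i; apply: gE.
exists g; split=> // i A bA.
rewrite (_ : _ @^-1` _ = [set x | exists V, c x V /\ nbr_in (cell U V i `&` A) x]).
  apply: borel_ex => V; apply: borel_and => //; apply: (borel_nbr_in bU).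
  by apply: borel_and => //; apply: (borel_cell bU).
apply/seteqP; split=> x /=.
  move=> Agx; have [V cV] := ex_c x; exists V; split=> //.
  by exists (g i x) => //; split=> //; apply: gP.
move=> [V [cV [y Exy [Vy Ay]]]]; have [j gj] := gs x y Exy.
suff <- : j = i by rewrite gj.
by apply: (@cell_inj U V j i y) => //; rewrite -gj; apply: gP.
Qed.

End NeighbourFunctions.

(** * Fractional perfect matchings *)

Section Reachability.
Variable X : choiceType.
Implicit Types (e : rel X) (x y z : X).

Definition reach e x y := exists2 p : seq X, path e x p & last x p = y.

Lemma reach_refl e x : reach e x x.
Proof. by exists [::]. Qed.

Lemma reach_trans e y x z : reach e x y -> reach e y z -> reach e x z.
Proof.
move=> [p xp <-] [q yq <-]; exists (p ++ q); last by rewrite last_cat.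
by rewrite cat_path xp.
Qed.

Lemma reach1 e x y : e x y -> reach e x y.
Proof. by move=> exy; exists [:: y] => //=; rewrite exy. Qed.

Lemma reach_sub e e' x y : (forall u v, e u v -> e' u v) -> reach e x y -> reach e' x y.
Proof. by move=> ee' [p xp <-]; exists p => //; apply: sub_path xp. Qed.

Lemma reach_sym e x y : (forall u v, e u v = e v u) -> reach e x y -> reach e y x.
Proof.
move=> es [p + <-]; elim: p x => [|z p IH] x /=; first by exists [::].
move=> /andP[xz /IH zp]; apply: reach_trans zp _; apply: reach1.
by rewrite es.
Qed.

Lemma reach_closed e (T : set X) x y : (forall u v, T u -> e u v -> T v) ->
  T x -> reach e x y -> T y.
Proof.
move=> cT + [p + <-]; elim: p x => [|z p IH] x //= Tx /andP[xz zp].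
by apply: IH zp; apply: cT xz.
Qed.

End Reachability.

(** * Fractional matchings, open edges and pushing along cycles *)

Section Weights.
Variables (X : choiceType) (d : nat) (g : 'I_d -> X -> X) (chi : X -> bool).
Hypothesis g_inj : forall x, injective (g^~ x).
Hypothesis g_sym : forall x i, exists j, g j (g i x) = x.
Hypothesis chi_g : forall x i, chi (g i x) = ~~ chi x.

(** Words in the neighbour indices are countably many names for the vertices in the component of
    [x]. *)
Definition walk (u : seq 'I_d) (x : X) : X := foldl (fun y i => g i y) x u.

Lemma walk_cat u v x : walk (u ++ v) x = walk v (walk u x).
Proof. by rewrite /walk foldl_cat. Qed.

Lemma walk_back u x : exists2 v, size v = size u & walk v (walk u x) = x.
Proof.
elim: u x => [|i u IH] x; first by exists [::].
have [v sv vK] := IH (g i x); have [j jK] := g_sym x i.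
by exists (v ++ [:: j]); rewrite ?size_cat ?sv ?addn1// walk_cat [walk (i :: u) x]/= vK.
Qed.

Definition gcomp x : set X := [set y | exists u, walk u x = y].

Lemma gcomp_refl x : gcomp x x.
Proof. by exists [::]. Qed.

Lemma gcomp_trans y x z : gcomp x y -> gcomp y z -> gcomp x z.
Proof. by move=> [u <-] [v <-]; exists (u ++ v); rewrite walk_cat. Qed.

Lemma gcomp_sym x y : gcomp x y -> gcomp y x.
Proof. by move=> [u <-]; have [v _ vK] := walk_back u x; exists v. Qed.

Lemma gcomp_g x i : gcomp x (g i x).
Proof. by exists [:: i]. Qed.

Definition weight := X -> X -> int.

Implicit Types (w : weight) (x y z u v a b : X).

Local Open Scope ring_scope.

Record fractional_matching w : Prop := {
  fm_sym : forall x y, w x y = w y x;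
  fm_ge0 : forall x y, 0 <= w x y;
  fm_le : forall x y, w x y <= d%:Z;
  fm_edge : forall x y, w x y <> 0 -> exists i, g i x = y;
  fm_sum : forall x, \sum_(i < d) w x (g i x) = d%:Z }.

Definition open_edge w : rel X := fun x y => 0 < w x y < d%:Z.

Definition in_infinite w x := infinite_set (reach (open_edge w) x).

Definition inner_boundary (e : rel X) x (U : set X) : set X :=
  [set a | [/\ gcomp x a, U a & exists2 b, ~ U b & e a b]].

(** One-endedness of the open graph inside each component, in terms of cuts: a cut with finite
    boundary has only finitely many vertices of infinite open components on one of its sides. In
    particular there is at most one infinite open component, see [in_infinite_reachable]. *)
Definition ends_ok w := forall x U, finite_set (inner_boundary (open_edge w) x U) ->
  finite_set [set a | [/\ gcomp x a, in_infinite w a & U a]] \/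
  finite_set [set a | [/\ gcomp x a, in_infinite w a & ~ U a]].

Definition side_sign x : int := if chi x then 1 else -1.

Lemma side_sign_g x i : side_sign (g i x) = - side_sign x.
Proof. by rewrite /side_sign chi_g; case: (chi x); rewrite ?opprK. Qed.

Lemma open_edge_sym w : fractional_matching w ->
  forall u v, open_edge w u v = open_edge w v u.
Proof. by move=> fw u v; rewrite /open_edge (fm_sym fw). Qed.

Lemma open_edge_g w : fractional_matching w ->
  forall u v, open_edge w u v -> exists i, g i u = v.
Proof.
move=> fw u v /andP[w0 _]; apply: (fm_edge fw).
by move=> w00; rewrite w00 in w0.
Qed.

Lemma reach_gcomp w : fractional_matching w ->
  forall x y, reach (open_edge w) x y -> gcomp x y.
Proof.
move=> fw x y; apply: (reach_closed (T := gcomp x)); last exact: gcomp_refl.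
move=> u v xu /(open_edge_g fw)[i <-]; apply: gcomp_trans xu _; exact: gcomp_g.
Qed.

Lemma fm_sum_seq w x (t : seq X) : fractional_matching w -> uniq t ->
  (forall i, g i x \in t) -> \sum_(y <- t) w x y = d%:Z.
Proof.
move=> fw ut nt; pose n := [seq g i x | i <- enum 'I_d].
have un : uniq n by rewrite map_inj_uniq ?enum_uniq//; apply: g_inj.
rewrite -(fm_sum fw x) -(big_enum _ _ _ (fun i => w x (g i x))) /=.
rewrite -(big_map (fun i => g i x) xpredT (w x)) -/n.
rewrite (bigID (mem n)) /= [X in _ + X]big1 ?addr0; last first.
  move=> y yn; apply: contrapT => /(fm_edge fw)[i iy]; move/negP: yn; apply.
  by apply/mapP; exists i => //; rewrite mem_enum.
rewrite -big_filter; apply: perm_big; apply: uniq_perm => //.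
  exact: filter_uniq.
move=> y; rewrite mem_filter; apply/andP/idP => [[]//|yn]; split=> //.
by move: yn => /mapP[i _ ->].
Qed.

(* Modulo [d], the signed sum of the weights leaving a finite set vanishes. *)
Lemma no_finite_bridge w (s : seq X) a b : fractional_matching w -> uniq s ->
  b \in s -> a \notin s -> open_edge w b a ->
  (forall u v, u \in s -> v \notin s -> open_edge w u v -> u = b /\ v = a) -> False.
Proof.
move=> fw us bs as_ ba bd.
pose nb v := [seq g i v | i <- enum 'I_d].
pose t := undup (s ++ flatten [seq nb v | v <- s]).
have ut : uniq t by apply: undup_uniq.
have st v : v \in s -> v \in t by move=> vs; rewrite mem_undup mem_cat vs.
have gt v i : v \in s -> g i v \in t.
  move=> vs; rewrite mem_undup mem_cat; apply/orP; right.
  by apply/flatten_mapP; exists v => //; apply/mapP; exists i; rewrite ?mem_enum.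
have at_ : a \in t by have [i <-] := open_edge_g fw ba; apply: gt.
pose Z := \sum_(v <- s) \sum_(y <- s) side_sign v * w v y.
(* Exchanging the two indices changes the sign, since the ends of an edge have opposite side
   signs. *)
have Z0 : Z = 0.
  have : Z = - Z.
    rewrite {1}/Z exchange_big /= /Z -sumrN; apply: eq_bigr => y _.
    rewrite -sumrN; apply: eq_bigr => v _; rewrite (fm_sym fw y v).
    have [->|w0] := eqVneq (w v y) 0; first by rewrite !mulr0 oppr0.
    have /eqP/(fm_edge fw)[i <-] := w0; by rewrite side_sign_g mulNr opprK.
  lia.
pose B := \sum_(v <- s) \sum_(y <- t | y \notin s) side_sign v * w v y.
have ZB : Z + B = d%:Z * \sum_(v <- s) side_sign v.
  rewrite /Z /B -big_split mulr_sumr /= big_seq [RHS]big_seq; apply: eq_bigr => v vs.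
  rewrite -(fm_sum_seq fw ut (fun i => gt v i vs)) mulr_suml.
  rewrite [in RHS](bigID (mem s)) /=; congr (_ + _); last first.
    by apply: eq_bigr => y _; rewrite mulrC.
  rewrite -[RHS]big_filter; under eq_bigr do rewrite mulrC.
  apply: perm_big; apply: uniq_perm => //; first exact: filter_uniq.
  move=> y; rewrite mem_filter; apply/idP/andP => [ys|[]//].
  by split=> //; apply: st.
(* Every edge leaving [s] other than the bridge is closed, so its weight is 0 or [d]. *)
have dv v y : v \in s -> y \notin s -> (v, y) != (b, a) -> (d %| w v y)%Z.
  move=> vs ys vy; have /negP := fun h => elimN eqP vy (let: conj e1 e2 := bd v y vs ys h in
    congr2 pair e1 e2).
  rewrite /open_edge negb_and -!leNgt => /orP[w0|wd].
    by rewrite (_ : w v y = 0) ?dvdz0//; apply/eqP; rewrite eq_le w0 fm_ge0.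
  by rewrite (_ : w v y = d%:Z) ?dvdzz//; apply/eqP; rewrite eq_le wd fm_le.
have dB : (d %| B - side_sign b * w b a)%Z.
  rewrite /B (bigD1_seq b) //= -big_filter (bigD1_seq a) /=; last 2 first.
  - by rewrite mem_filter as_ at_.
  - exact: filter_uniq.
  have eq3 (x y z : int) : x + y + z - x = y + z by lia.
  rewrite eq3; apply: rpredD.
    rewrite big_seq_cond; apply: rpred_sum => y /andP[]; rewrite mem_filter => /andP[ys _] ya.
    by rewrite dvdz_mull// dv// xpair_eqE (negPf ya) andbF.
  rewrite big_seq_cond; apply: rpred_sum => v /andP[vs vb].
  apply: rpred_sum => y ys.
  by rewrite dvdz_mull// dv// xpair_eqE (negPf vb).
(* The total [Z + B] is a multiple of [d] and [Z] is 0, so the bridge alone carries a multiple of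
   [d], impossible strictly between 0 and [d]. *)
have dw : (d %| w b a)%Z.
  have : (d %| side_sign b * w b a)%Z.
    rewrite (_ : side_sign b * w b a = B - (B - side_sign b * w b a)); last by rewrite opprB addrC subrK.
    apply: rpredB => //; by rewrite -[B]add0r -Z0 ZB dvdz_mulr.
  by rewrite /side_sign; case: (chi b); rewrite ?mul1r // mulN1r rpredN.
move: ba dw; rewrite /open_edge => /andP[w0 wd] /dvdzP[q qw].
rewrite qw in w0 wd; have [q0|q0] := lerP q 0.
  by move: w0; rewrite ltNge mulr_le0_ge0.
by move: wd; rewrite ltNge ler_peMl.
Qed.

Lemma in_infinite_sub w x (e : rel X) : fractional_matching w ->
  (forall u v, e u v -> open_edge w u v) -> infinite_set (reach e x) -> in_infinite w x.
Proof.
move=> fw ew inf fin; apply: inf; apply: sub_finite_set fin => y.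
exact: reach_sub.
Qed.

Lemma in_infinite_reach w x y : fractional_matching w -> reach (open_edge w) x y ->
  in_infinite w x -> in_infinite w y.
Proof.
move=> fw xy ix fin; apply: ix; apply: sub_finite_set fin => z xz.
apply: reach_trans xz; apply: reach_sym xy; exact: open_edge_sym.
Qed.

(** If deleting the edge separated [a] from [b], both sides would be infinite by [no_finite_bridge].
    The side of [b] would then be a cut with boundary inside [{b}] and infinitely many vertices of
    infinite open components on both sides, against [ends_ok]. *)
Lemma cycle_through w a b : fractional_matching w -> ends_ok w -> open_edge w a b ->
  exists p, [/\ path (fun u v => [&& open_edge w u v, (u, v) != (a, b) & (u, v) != (b, a)]) a p,
    last a p = b & uniq (a :: p)].
Proof.
move=> fw ow ab; set e := (fun u v => _).
have ee u v : e u v -> open_edge w u v by case/and3P.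
have es u v : e u v = e v u.
  rewrite /e (open_edge_sym fw u) !xpair_eqE; congr (_ && _).
  by rewrite andbC [(u == b) && _]andbC [(u == a) && _]andbC.
suff [p ap pb] : reach e a b by case: (shortenP ap) pb => q aq uq _ qb; exists q.
apply: contrapT => nab.
have nba : ~ reach e b a by move=> ba; apply: nab; apply: reach_sym ba.
have inf x y : open_edge w x y -> (x, y) = (a, b) \/ (x, y) = (b, a) ->
    ~ reach e x y -> infinite_set (reach e x).
  move=> xy ends nxy /finite_seqP[s0 sE].
  have mem u : reach e x u <-> u \in undup s0.
    rewrite mem_undup; split=> [xu|us]; first by have : [set` s0] u by rewrite -sE.
    by have : reach e x u by rewrite sE.
  apply: (@no_finite_bridge w (undup s0) y x) => //.
  - exact: undup_uniq.
  - by apply/mem; exact: reach_refl.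
  - by apply/negP => /mem.
  move=> u v /mem xu /negP vs uv.
  have : ~ e u v by move=> euv; apply: vs; apply/mem; apply: reach_trans xu (reach1 euv).
  rewrite /e uv /= => /negP; rewrite negb_and !negbK => uvab.
  have [//|[ux _]] : (u = x /\ v = y) \/ (u = y /\ v = x); last first.
    by case: nxy; rewrite -ux.
  by case: ends uvab => -[-> ->] /orP[/eqP[-> ->]|/eqP[-> ->]]; [left|right|right|left].
have ia := inf a b ab (or_introl erefl) nab.
have ba : open_edge w b a by rewrite open_edge_sym.
have ib := inf b a ba (or_intror erefl) nba.
have infe x y : infinite_set (reach e x) -> reach e x y -> in_infinite w y.
  move=> ix xy; apply: (in_infinite_sub fw ee) => fin; apply: ix; apply: sub_finite_set fin => z.
  by apply: reach_trans; apply: reach_sym xy.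
have [|fin|fin] := ow b (reach e b).
- apply: (@sub_finite_set _ _ [set b]) => [u [_ bu [v nbv uv]]|]; last exact: finite_set1.
  have : ~ e u v by move=> euv; apply: nbv; apply: reach_trans bu (reach1 euv).
  rewrite /e uv /= => /negP; rewrite negb_and !negbK => /orP[/eqP[ua]|/eqP[]//].
  by case: nba; rewrite -ua.
- case: (ib); apply: sub_finite_set fin => y bY; split=> //.
    by apply: (reach_gcomp fw); apply: reach_sub bY.
  exact: infe ib bY.
- case: (ia); apply: sub_finite_set fin => y aY; split.
  + apply: (@gcomp_trans a).
      by have [i <-] := open_edge_g fw ba; apply: gcomp_g.
    by apply: (reach_gcomp fw); apply: reach_sub aY.
  + exact: infe ia aY.
  + move=> bY; apply: nba; apply: reach_trans bY _; exact: reach_sym aY.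
Qed.

(** The sign is that of the starting point, so the changes along a path alternate between adding and
    subtracting one. *)
Definition push1 (w : weight) (a b x y : X) : int :=
  w x y + (if ((x == a) && (y == b)) || ((x == b) && (y == a)) then side_sign a else 0).

Fixpoint push (w : weight) (a : X) (p : seq X) {struct p} : weight :=
  if p is b :: p' then push (push1 w a b) b p' else w.

Lemma push1_sym w a b : (forall x y, w x y = w y x) ->
  forall x y, push1 w a b x y = push1 w a b y x.
Proof.
move=> sw x y; rewrite /push1 sw [(x == a) && _]andbC [(x == b) && _]andbC.
by rewrite orbC.
Qed.

Lemma push_sym p w a : (forall x y, w x y = w y x) ->
  forall x y, push w a p x y = push w a p y x.
Proof. by elim: p w a => //= b p IH w a sw; apply/IH/push1_sym. Qed.

Definition delta a z : int := if z == a then side_sign a else 0.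

(** The sums at [a] and at [b] both change by [side_sign a], which equals [- side_sign b]. Written
    as a difference of deltas, the changes along a path telescope in [push_sum]. *)
Lemma push1_sum w a b z : (exists i, g i a = b) ->
  \sum_(i < d) push1 w a b z (g i z) = \sum_(i < d) w z (g i z) + delta a z - delta b z.
Proof.
move=> [i0 ab]; rewrite big_split -addrA /=; congr (_ + _).
have [j0 ba] := g_sym a i0; rewrite ab in ba.
have sb : side_sign b = - side_sign a by rewrite -ab side_sign_g.
have nab : a != b by apply: contra_eqN ab => /eqP <-; apply/eqP => /(congr1 chi);
  rewrite chi_g; case: (chi a).
rewrite /delta; have [->|za] := eqVneq z a.
  rewrite (negPf nab) subr0 (bigD1 i0) //= ab eqxx big1 ?addr0 // => i ii0.
  have [iab|//] := eqVneq (g i a) b.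
  by move/negP: ii0 => []; apply/eqP; apply: (@g_inj a); rewrite iab.
have [->|zb] := eqVneq z b.
  rewrite sb opprK add0r (bigD1 j0) //= ba eqxx big1 ?addr0 // => i ii0.
  have [iab|//] := eqVneq (g i b) a.
  by move/negP: ii0 => []; apply/eqP; apply: (@g_inj b); rewrite iab.
by rewrite subr0 big1.
Qed.

Lemma push_sum p w a z : path (fun u v => `[< exists i, g i u = v >]) a p ->
  \sum_(i < d) push w a p z (g i z) =
  \sum_(i < d) w z (g i z) + delta a z - delta (last a p) z.
Proof.
elim: p w a => [|b p IH] w a /=; first by rewrite addrK.
move=> /andP[/asboolP ab bp]; rewrite IH // push1_sum //.
by rewrite subrK.
Qed.

(** A path without repeated vertices uses each edge at most once, so no weight changes by more than
    one. *)
Lemma push_value p w a (e : rel X) : (forall u v, e u v = e v u) -> path e a p ->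
  uniq (a :: p) -> forall u v, push w a p u v = w u v \/
  [/\ e u v, u \in a :: p, v \in a :: p &
    push w a p u v = w u v + 1 \/ push w a p u v = w u v - 1].
Proof.
move=> es; elim: p w a => [|b p IH] w a; first by left.
move=> /= /andP[ab bp] /andP[an ubp] u v.
have [->|[euv ub vb H]] := IH (push1 w a b) b bp ubp u v.
  rewrite /push1; case: ifP => [|_]; last by rewrite addr0; left.
  move=> H; right; split.
  - by case/orP: H => /andP[/eqP -> /eqP ->] //; rewrite es.
  - by case/orP: H => /andP[/eqP -> _]; rewrite !inE eqxx ?orbT.
  - by case/orP: H => /andP[_ /eqP ->]; rewrite !inE eqxx ?orbT.
  - by rewrite /side_sign; case: (chi a); [left|right].
have e1 : push1 w a b u v = w u v.
  rewrite /push1; case: ifP; rewrite ?addr0 // => /orP[/andP[/eqP ua _]|/andP[_ /eqP va]].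
    by move/negP: an => []; rewrite -ua.
  by move/negP: an => []; rewrite -va.
by rewrite e1 in H; right; split=> //; rewrite inE ?ub ?vb orbT.
Qed.

Definition changes_in w w' (Z : seq X) := forall u v, w' u v <> w u v ->
  [/\ u \in Z, v \in Z & open_edge w u v].

(** The path from [cycle_through] avoids the edge between [a] and [b] and is closed up by a push
    from [b] to [a], which subtracts one by the sign of [b]. The bounds survive because only open
    edges change, each by one unit. *)
Lemma push_cycle w a b : fractional_matching w -> ends_ok w -> open_edge w a b ->
  side_sign b = -1 -> exists w1 Z, [/\ fractional_matching w1, changes_in w w1 Z,
    w1 a b = w a b - 1 & forall z, z \in Z -> gcomp a z].
Proof.
move=> fw ow ab sb; have [p [ap pb up]] := cycle_through fw ow ab.
set e := (fun u v => _) in ap.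
have ee u v : e u v -> open_edge w u v by case/and3P.
have es u v : e u v = e v u.
  rewrite /e (open_edge_sym fw u) !xpair_eqE; congr (_ && _).
  by rewrite andbC [(u == b) && _]andbC [(u == a) && _]andbC.
have ba : open_edge w b a by rewrite open_edge_sym.
have bp : b \in a :: p by rewrite -pb mem_last.
have val u v := push_value w es ap up u v.
have valab : push w a p a b = w a b.
  by have [//|[]] := val a b; rewrite /e eqxx andbF.
pose w1 := push1 (push w a p) b a.
have w1ab : w1 a b = w a b - 1.
  by rewrite /w1 /push1 valab !eqxx orbT sb.
have w1s x y : w1 x y = w1 y x by apply/push1_sym/push_sym/(fm_sym fw).
have w1v u v : w1 u v = w u v \/ [/\ u \in a :: p, v \in a :: p, open_edge w u v &
    w1 u v = w u v + 1 \/ w1 u v = w u v - 1].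
  have [uv|nuv] := boolP (((u == b) && (v == a)) || ((u == a) && (v == b))).
    right; case/orP: uv => /andP[/eqP -> /eqP ->]; split; rewrite ?mem_head ?ba //.
      by right; rewrite w1s w1ab (fm_sym fw).
    by right.
  rewrite /w1 /push1 (negPf nuv) addr0; have [|[euv ? ? ?]] := val u v; [by left|right].
  by split=> //; apply: ee.
exists w1, (a :: p); split=> //.
- split=> //.
  + move=> x y; have [->|[_ _ /andP[h1 h2] H]] := w1v x y; first exact: fm_ge0.
    lia.
  + move=> x y; have [->|[_ _ /andP[h1 h2] H]] := w1v x y; first exact: fm_le.
    lia.
  + move=> x y; have [->|[_ _ xy _] _] := w1v x y; first exact: fm_edge.
    exact: open_edge_g fw _ _ xy.
  + move=> x; rewrite push1_sum; last exact: open_edge_g fw _ _ ba.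
    rewrite push_sum ?pb; last first.
      by apply: sub_path ap => u v /ee uv; apply/asboolP; exact: open_edge_g fw _ _ uv.
    by rewrite subrK addrK fm_sum.
- by move=> u v H; have [//|[]] := w1v u v.
- move=> z; have := ap; elim: (p) (a) z => [|y q IH] c z /=.
    by rewrite inE => _ /eqP ->; exact: gcomp_refl.
  move=> /andP[/ee/(open_edge_g fw)[i cy] yq]; rewrite inE => /orP[/eqP ->|zq].
    exact: gcomp_refl.
  by apply: gcomp_trans (IH y z yq zq); rewrite -cy; apply: gcomp_g.
Qed.

Lemma changes_open_edge w w' Z : changes_in w w' Z ->
  forall u v, open_edge w' u v -> open_edge w u v.
Proof.
move=> ch u v uv; have [eq|ne] := pselect (w' u v = w u v).
  by move: uv; rewrite /open_edge eq.
by case: (ch u v ne).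
Qed.

Lemma in_infinite_changes w w' Z x : fractional_matching w -> changes_in w w' Z ->
  in_infinite w' x -> in_infinite w x.
Proof. by move=> fw /changes_open_edge; apply: in_infinite_sub. Qed.

(** Boundaries for the two weights differ only inside the finite list [Z], and vertices of infinite
    open components for [w'] are such for [w]. *)
Lemma ends_ok_changes w w' Z : fractional_matching w -> changes_in w w' Z ->
  ends_ok w -> ends_ok w'.
Proof.
move=> fw ch ow x U fin.
have [||] := ow x U.
- apply: (@sub_finite_set _ _ (inner_boundary (open_edge w') x U `|` [set` Z])).
    move=> u [xu Uu [v nUv uv]]; have [eq|ne] := pselect (w' u v = w u v); last first.
      by right; case: (ch u v ne).
    by left; split=> //; exists v => //; rewrite /open_edge eq.
  by rewrite finite_setU; split=> //; exact: finite_seq.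
- move=> fin'; left; apply: sub_finite_set fin' => u [? /(in_infinite_changes fw ch) ? ?].
  by split.
- move=> fin'; right; apply: sub_finite_set fin' => u [? /(in_infinite_changes fw ch) ? ?].
  by split.
Qed.

Lemma changes_trans w w1 w2 Z1 Z2 : changes_in w w1 Z1 -> changes_in w1 w2 Z2 ->
  changes_in w w2 (Z1 ++ Z2).
Proof.
move=> c1 c2 u v ne; rewrite !mem_cat.
have [e1|n1] := pselect (w1 u v = w u v); last by have [-> -> ->] := c1 _ _ n1.
have [e2|n2] := pselect (w2 u v = w1 u v); first by case: ne; rewrite e2.
by have [-> -> /(changes_open_edge c1) ->] := c2 _ _ n2; rewrite !orbT.
Qed.

(** Each [push_cycle] lowers the weight of the edge by one, so after finitely many rounds the edge
    is no longer open. *)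
Lemma integrate_edge w a i : fractional_matching w -> ends_ok w ->
  exists w' Z, [/\ fractional_matching w', changes_in w w' Z,
    ~~ open_edge w' a (g i a) & forall z, z \in Z -> gcomp a z].
Proof.
move=> fw ow; set b := g i a.
(* The ends of the edge are ordered as [c], [f] so that [f] has the negative sign that [push_cycle]
   requires. *)
suff H c f : (c = a /\ f = b) \/ (c = b /\ f = a) -> side_sign f = -1 ->
    exists w' Z, [/\ fractional_matching w', changes_in w w' Z,
    ~~ open_edge w' c f & forall z, z \in Z -> gcomp c z].
  have [sb|sa] : side_sign b = -1 \/ side_sign a = -1.
    by rewrite /b side_sign_g /side_sign; case: (chi a); [left|right].
  - by apply: H => //; left.
  - have [w' [Z [fw' ch nba cZ]]] := H b a (or_intror (conj erefl erefl)) sa.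
    exists w', Z; split=> //; first by rewrite (open_edge_sym fw').
    by move=> z /cZ; apply: gcomp_trans; apply: gcomp_g.
move=> cf sf; have [n nw] : exists n : nat, w c f = n%:Z.
  by exists `|w c f|%N; rewrite gez0_abs // fm_ge0.
elim: n w fw ow nw => [|n IH] w fw ow nw.
  by exists w, [::]; split=> //; rewrite /open_edge nw ltxx.
have [cfo|nc] := boolP (open_edge w c f); last by exists w, [::]; split.
have [w1 [Z1 [fw1 ch1 w1v cZ1]]] := push_cycle fw ow cfo sf.
have [|w' [Z2 [fw' ch2 nco cZ2]]] := IH w1 fw1 (ends_ok_changes fw ch1 ow).
  by rewrite w1v nw; lia.
exists w', (Z1 ++ Z2); split=> //; first exact: changes_trans ch1 ch2.
by move=> z; rewrite mem_cat => /orP[/cZ1|/cZ2].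
Qed.

(** The open component of [u] is a cut with empty boundary; were [v] outside, both sides would be
    infinite. *)
Lemma in_infinite_reachable w u v : fractional_matching w -> ends_ok w ->
  in_infinite w u -> in_infinite w v -> gcomp u v -> reach (open_edge w) u v.
Proof.
move=> fw ow iu iv uv; apply: contrapT => nuv.
have [|fin|fin] := ow u (reach (open_edge w) u).
- rewrite (_ : inner_boundary _ _ _ = set0) //; apply/seteqP; split=> // a [_ ua [b nub ab]].
  by apply: nub; apply: reach_trans ua (reach1 ab).
- case: (iu); apply: sub_finite_set fin => y uy; split=> //.
    exact: reach_gcomp uy.
  exact: in_infinite_reach iu.
- case: (iv); apply: sub_finite_set fin => y vy; split=> //.
  + by apply: gcomp_trans uv _; exact: reach_gcomp vy.
  + exact: in_infinite_reach iv.
  + move=> uy; apply: nuv; apply: reach_trans uy _; apply: reach_sym vy.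
    exact: open_edge_sym.
Qed.

(* [W] is the part of [S] that lies in the infinite component of [w]: it is
   connected inside [S], and the rest of [S] is a union of finite components. *)
Record frame w (S W : seq X) : Prop := {
  fr_sub : forall u, u \in W -> u \in S;
  fr_conn : forall T : set X,
    (forall u v, u \in S -> v \in S -> T u -> open_edge w u v -> T v) ->
    forall c u, c \in W -> u \in W -> T c -> T u;
  fr_closed : forall u v, u \in S -> u \notin W -> open_edge w u v ->
    v \in S /\ v \notin W }.

Lemma path_closed (e : rel X) (T : set X) x p : (forall u v, e u v = e v u) ->
  path e x p -> (forall u v, u \in x :: p -> v \in x :: p -> T u -> e u v -> T v) ->
  forall u, u \in x :: p -> T x <-> T u.
Proof.
move=> es; elim: p x => [|y p IH] x /=.
  by move=> _ _ u; rewrite inE => /eqP ->.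
move=> /andP[xy yp] cT u; rewrite inE => /orP[/eqP -> //|uyp].
have xin : x \in [:: x, y & p] by rewrite mem_head.
have yin : y \in [:: x, y & p] by rewrite !inE eqxx orbT.
have <- : T y <-> T u.
  apply: IH => // a b ai bi; apply: cT; rewrite inE ?ai ?bi orbT //.
split=> [Tx|Ty]; first exact: cT xy.
by apply: (cT y) => //; rewrite es.
Qed.

(** [W] consists of open paths from a base point [z0] to the points of [Z] in the infinite open
    component; [S] adds the entire finite open components of the other points of [Z]. *)
Lemma frame_exists w x (Z : seq X) : fractional_matching w -> ends_ok w ->
  (forall z, z \in Z -> gcomp x z) -> exists S W,
    [/\ frame w S W, forall z, z \in Z -> z \in S & forall z, z \in S -> gcomp x z].
Proof.
move=> fw ow xZ; set e := open_edge w.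
have es : forall u v, e u v = e v u := open_edge_sym fw.
have /choice[F HF] : forall z, exists s : seq X,
    (in_infinite w z -> s = [::]) /\ (~ in_infinite w z -> reach e z = [set` s]).
  move=> z; have [iz|/contrapT/finite_seqP[s sE]] := pselect (in_infinite w z).
    by exists [::].
  exists s; split=> // iz; exfalso; apply: iz; rewrite -/e sE; exact: finite_seq.
(* If no point of [Z] lies in an infinite component, [z0] is the default [x] and [W] is empty. *)
have [z0 Hz0] : exists z0 : X, forall z, z \in Z -> in_infinite w z -> in_infinite w z0 /\ gcomp z0 z.
  have [[z0 z0Z iz0]|nex] := pselect (exists2 z, z \in Z & in_infinite w z); last first.
    by exists x => z zZ iz; case: nex; exists z.
  exists z0 => z zZ iz; split=> //; apply: gcomp_trans (xZ z zZ).
  exact/gcomp_sym/xZ.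
have /choice[P HP] : forall z, exists p : seq X, z \in Z -> in_infinite w z ->
    path e z0 p /\ last z0 p = z.
  move=> z; have [[zZ iz]|nz] := pselect (z \in Z /\ in_infinite w z); last first.
    by exists [::] => ? ?; case: nz.
  have [iz0 z0z] := Hz0 z zZ iz; have [p ? ?] := in_infinite_reachable fw ow iz0 iz z0z.
  by exists p.
pose W := flatten [seq z0 :: P z | z <- Z & `[< in_infinite w z >]].
pose S := W ++ flatten [seq F z | z <- Z].
have WP u : u \in W -> exists z, [/\ z \in Z, in_infinite w z & u \in z0 :: P z].
  move=> /flatten_mapP[z]; rewrite mem_filter => /andP[/asboolP iz zZ] uz.
  by exists z.
have PW z u : z \in Z -> in_infinite w z -> u \in z0 :: P z -> u \in W.
  move=> zZ iz uz; apply/flatten_mapP; exists z => //.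
  by rewrite mem_filter zZ andbT; apply/asboolP.
have Wreach u : u \in W -> in_infinite w z0 /\ reach e z0 u.
  move=> /WP[z [zZ iz uz]]; have [iz0 _] := Hz0 z zZ iz; split=> //.
  have [zp _] := HP z zZ iz.
  apply: (path_closed es zp _ uz).1; last exact: reach_refl.
  by move=> a b _ _ za ab; apply: reach_trans za (reach1 ab).
have SF u : u \in S -> u \notin W -> exists z, [/\ z \in Z, ~ in_infinite w z & reach e z u].
  rewrite mem_cat => /orP[-> //|/flatten_mapP[z zZ uz] _].
  have [/(HF z).1 Fz|niz] := pselect (in_infinite w z); first by rewrite Fz in uz.
  by exists z; split=> //; rewrite (HF z).2.
have FS z u : z \in Z -> ~ in_infinite w z -> reach e z u -> u \in S.
  move=> zZ niz zu; rewrite mem_cat; apply/orP; right; apply/flatten_mapP.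
  by exists z => //; have := zu; rewrite (HF z).2.
have nWF z u : ~ in_infinite w z -> reach e z u -> u \notin W.
  move=> niz zu; apply/negP => /Wreach[iz0 z0u]; apply: niz.
  apply: in_infinite_reach iz0 => //; apply: reach_trans z0u _; exact: reach_sym zu.
exists S, W; split.
- split.
  + by move=> u uW; rewrite mem_cat uW.
  + move=> T cT c u cW uW.
    have TW v : v \in W -> T z0 <-> T v.
      move=> /WP[z [zZ iz vz]]; have [zp _] := HP z zZ iz.
      apply: path_closed es zp _ _ vz => a b ai bi; apply: cT.
        by rewrite mem_cat (PW z).
      by rewrite mem_cat (PW z).
    by move=> /(TW c cW)/(TW u uW).
  + move=> u v uS uW uv; have [z [zZ niz zu]] := SF u uS uW.
    have zv : reach e z v by apply: reach_trans zu (reach1 uv).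
    by split; [apply: FS zv|apply: nWF zv].
- move=> z zZ; have [iz|niz] := pselect (in_infinite w z); last first.
    by apply: (FS z) => //; exact: reach_refl.
  rewrite mem_cat (PW z) //; have [_ {1}<-] := HP z zZ iz.
  exact: mem_last.
- move=> z; rewrite mem_cat => /orP[/WP[y [yZ iy zy]]|/flatten_mapP[y yZ zF]].
    have zW := PW y z yZ iy zy; have [iz0 z0z] := Wreach z zW.
    have [_ z0y] := Hz0 y yZ iy; apply: gcomp_trans (xZ y yZ) _.
    by apply: gcomp_trans (gcomp_sym z0y) _; apply: reach_gcomp z0z.
  have [/(HF y).1 Fy|niy] := pselect (in_infinite w y); first by rewrite Fy in zF.
  apply: gcomp_trans (xZ y yZ) _; apply: (reach_gcomp fw); rewrite -/e.
  by rewrite (HF y).2.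
Qed.

(** * Simultaneous changes on pairwise disjoint finite sets *)

Section Glue.
Variables (w : weight) (A : set X) (S W : X -> seq X) (w2 : X -> weight).
Hypothesis fw : fractional_matching w.
Hypothesis fw2 : forall x, A x -> fractional_matching (w2 x).
Hypothesis ch2 : forall x, A x -> changes_in w (w2 x) (S x).
Hypothesis Scc : forall x z, A x -> z \in S x -> gcomp x z.
Hypothesis disj : forall x y z, A x -> A y -> z \in S x -> z \in S y -> x = y.

(** Only the first argument selects the local weight; by [glue_r] the second one gives the same
    value, because a local change affects only pairs with both ends in one [S x]. *)
Definition glue_weight : weight := fun a b =>
  if pselect (exists2 x, A x & a \in S x) is left h then w2 (s2val (cid2 h)) a b
  else w a b.

Lemma glue_l x a b : A x -> a \in S x -> glue_weight a b = w2 x a b.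
Proof.
move=> Ax aS; rewrite /glue_weight; case: pselect => [h|]; last by case; exists x.
by case: cid2 => y Ay ay /=; rewrite (disj Ax Ay aS ay).
Qed.

Lemma glue_out a b : (forall x, A x -> a \notin S x) -> glue_weight a b = w a b.
Proof.
move=> na; rewrite /glue_weight; case: pselect => // -[x Ax ax].
by move: (na x Ax); rewrite ax.
Qed.

Lemma unchanged x a b : A x -> a \notin S x \/ b \notin S x -> w2 x a b = w a b.
Proof.
move=> Ax nab; apply: contrapT => /(ch2 Ax)[aS bS _].
by move: nab; rewrite aS bS; case.
Qed.

Lemma glue_r x a b : A x -> b \in S x -> glue_weight a b = w2 x a b.
Proof.
move=> Ax bS; have [aS|naS] := boolP (a \in S x); first exact: glue_l.
rewrite (@unchanged x) //; last by left.
have [[y Ay ay]|na] := pselect (exists2 y, A y & a \in S y).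
  rewrite (glue_l _ Ay ay) (@unchanged y) //; right.
  by apply/negP => by_; move: naS; rewrite (disj Ax Ay bS by_) ay.
by apply: glue_out => y Ay; apply/negP => ay; apply: na; exists y.
Qed.

Lemma glue_cases a b : glue_weight a b = w a b \/
  exists x, [/\ A x, glue_weight a b = w2 x a b, a \in S x & b \in S x].
Proof.
have [[x Ax aS]|na] := pselect (exists2 x, A x & a \in S x).
  have [bS|nbS] := boolP (b \in S x).
    by right; exists x; split=> //; apply: glue_l.
  by left; rewrite (glue_l _ Ax aS) (@unchanged x) //; right.
by left; apply: glue_out => x Ax; apply/negP => aS; apply: na; exists x.
Qed.

Lemma glue_fm : fractional_matching glue_weight.
Proof.
split.
- move=> x y.
  have [[z Az xS]|nx] := pselect (exists2 z, A z & x \in S z).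
    by rewrite (glue_l _ Az xS) (glue_r _ Az xS) (fm_sym (fw2 Az)).
  have [[z Az yS]|ny] := pselect (exists2 z, A z & y \in S z).
    by rewrite (glue_l _ Az yS) (glue_r _ Az yS) (fm_sym (fw2 Az)).
  have -> : glue_weight x y = w x y.
    by apply: glue_out => z Az; apply/negP => xS; apply: nx; exists z.
  have -> : glue_weight y x = w y x.
    by apply: glue_out => z Az; apply/negP => yS; apply: ny; exists z.
  exact: (fm_sym fw).
- by move=> x y; have [->|[z [Az -> _ _]]] := glue_cases x y; [apply: fm_ge0|apply: fm_ge0 (fw2 Az) _ _].
- by move=> x y; have [->|[z [Az -> _ _]]] := glue_cases x y; [apply: fm_le|apply: fm_le (fw2 Az) _ _].
- by move=> x y; have [->|[z [Az -> _ _]]] := glue_cases x y; [apply: fm_edge|apply: fm_edge (fw2 Az) _ _].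
- move=> x; have [[z Az xS]|na] := pselect (exists2 z, A z & x \in S z).
    by rewrite -(fm_sum (fw2 Az) x); apply: eq_bigr => i _; apply: glue_l.
  rewrite -(fm_sum fw x); apply: eq_bigr => i _; apply: glue_out => z Az.
  by apply/negP => xS; apply: na; exists z.
Qed.

Lemma glue_changes u v : glue_weight u v <> w u v -> open_edge w u v.
Proof. by have [//|[x [Ax -> _ _]]] := glue_cases u v; case/(ch2 Ax). Qed.

Lemma glue_open_edge u v : open_edge glue_weight u v -> open_edge w u v.
Proof.
move=> uv; have [eq|/glue_changes//] := pselect (glue_weight u v = w u v).
by move: uv; rewrite /open_edge eq.
Qed.

Hypothesis frS : forall x, A x -> frame (w2 x) (S x) (W x).

(** A frame only tests open edges starting in [S x], where the glued weight is [w2 x]. *)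
Lemma frame_glue x : A x -> frame glue_weight (S x) (W x).
Proof.
move=> Ax; have [f1 f2 f3] := frS Ax; split=> //.
- move=> T cT c u cW uW; apply: f2 => // a b aS bS Ta ab; apply: (cT a) => //.
  by rewrite /open_edge (glue_l _ Ax aS).
- move=> u v uS uW; rewrite /open_edge (glue_l _ Ax uS); exact: f3.
Qed.

(** The part of [S x] outside [W x] is finite and no open edge leaves it. *)
Lemma in_infinite_glue x u : A x -> u \in S x -> in_infinite glue_weight u -> u \in W x.
Proof.
move=> Ax uS iu; apply: contrapT => /negP nuW; apply: iu.
apply: (sub_finite_set _ (finite_seq (S x))) => v uv /=.
suff : v \in S x /\ v \notin W x by case.
move: uv; apply: (reach_closed (T := [set v | v \in S x /\ v \notin W x])) => //.
by move=> a b [aS aW]; apply: (fr_closed (frame_glue Ax)).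
Qed.

Lemma in_infinite_unglue u : in_infinite glue_weight u -> in_infinite w u.
Proof. by apply: in_infinite_sub fw _ => a b; apply: glue_open_edge. Qed.

(* A cut [U] of the glued weight with finite boundary is moved to a cut [U'] of
   [w] by making each [S x] that misses the boundary lie on the side of [W x]. *)
Lemma glue_ends_ok : ends_ok w -> ends_ok glue_weight.
Proof.
move=> ow x U finB; set B := inner_boundary _ _ _ in finB.
(* [F] is the boundary together with every [S y] that meets it; by disjointness each boundary vertex
   adds at most one finite set. *)
pose F := [set a | B a \/ exists y, [/\ A y, a \in S y & exists2 b, B b & b \in S y]].
have finF : finite_set F.
  have /choice[Sb HSb] : forall b, exists s : seq X,
      forall y, A y -> b \in S y -> s = S y.
    move=> b; have [[y Ay by_]|nb] := pselect (exists2 y, A y & b \in S y).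
      by exists (S y) => z Az bz; rewrite (disj Ay Az by_ bz).
    by exists [::] => y Ay by_; case: nb; exists y.
  apply: (@sub_finite_set _ _ (B `|` \bigcup_(b in B) [set` Sb b])).
    move=> a [Ba|[y [Ay aS [b Bb bS]]]]; [by left|right; exists b => //=].
    by rewrite (HSb b y).
  rewrite finite_setU; split=> //; exact: bigcup_finite.
(* On an [S y] that misses the boundary, [U'] is everything or nothing, according to whether [W y]
   meets [U]; elsewhere it is [U]. *)
pose U' : set X := fun a => if pselect (exists y, [/\ A y, a \in S y &
    ~ exists2 b, B b & b \in S y]) is left _
  then exists y, [/\ A y, a \in S y & exists2 c, c \in W y & U c] else U a.
have U'in y a : A y -> a \in S y -> ~ F a -> U' a <-> exists2 c, c \in W y & U c.
  move=> Ay aS nFa; rewrite /U'; case: pselect => [_|[]]; last first.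
    by exists y; split=> // H; apply: nFa; right; exists y.
  by split=> [[z [Az az]]|H]; [rewrite (disj Ay Az aS az)|exists y].
have U'out a : (forall y, A y -> a \notin S y) -> U' a <-> U a.
  move=> na; rewrite /U'; case: pselect => // -[y [Ay aS _]].
  by move: (na y Ay); rewrite aS.
(* [W y] is connected inside [S y], so when [S y] misses the boundary, [W y] lies on one side of
   [U]. *)
have Wmove y a : A y -> a \in S y -> gcomp x a -> ~ F a ->
    (exists2 c, c \in W y & U c) -> forall c, c \in W y -> U c.
  move=> Ay aS xa nFa [c cW Uc] c' c'W.
  apply: (fr_conn (frame_glue Ay) (T := fun v => U v)) Uc => //.
  move=> u v uS vS Uu uv; apply: contrapT => nUv; apply: nFa; right; exists y.
  split=> //; exists u => //; split=> //; last by exists v.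
  by apply: gcomp_trans xa _; apply: gcomp_trans (gcomp_sym (Scc Ay aS)) _; apply: Scc uS.
have WU y a : A y -> a \in W y -> gcomp x a -> ~ F a -> U' a <-> U a.
  move=> Ay aW xa nFa; have aS := fr_sub (frame_glue Ay) aW.
  rewrite (U'in y) //; split=> [H|Ua]; last by exists a.
  exact: Wmove Ay aS xa nFa H a aW.
have infU a : in_infinite glue_weight a -> gcomp x a -> ~ F a -> U' a <-> U a.
  move=> ia xa nFa; have [[y Ay aS]|na] := pselect (exists2 y, A y & a \in S y).
    by apply: (WU y) => //; apply: in_infinite_glue ia.
  by apply: U'out => y Ay; apply/negP => aS; apply: na; exists y.
have crossing a b : gcomp x a -> ~ F a -> open_edge glue_weight a b ->
    (forall y, A y -> a \in S y -> b \notin S y) -> U' a <-> U a.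
  move=> xa nFa ab sep; have [[y Ay aS]|na] := pselect (exists2 y, A y & a \in S y).
    apply: (WU y) => //; apply: contrapT => /negP aW.
    have [bS _] := fr_closed (frame_glue Ay) aS aW ab.
    by move: (sep y Ay aS); rewrite bS.
  by apply: U'out => y Ay; apply/negP => aS; apply: na; exists y.
have finB' : finite_set (inner_boundary (open_edge w) x U').
  have finFn : finite_set (\bigcup_(a in F) [set b | exists i, g i a = b]).
    apply: bigcup_finite => // a _.
    apply: sub_finite_set (finite_seq [seq g i a | i <- enum 'I_d]) => b [i <-] /=.
    by apply/mapP; exists i => //; rewrite mem_enum.
  (* Away from [F] and its neighbours, a boundary edge of [U'] cannot lie inside one [S y]. Its
     weight is then unchanged by the gluing and [U'] agrees with [U] at both ends, so it would be a
     boundary edge of [U]. *)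
  apply: (@sub_finite_set _ _ (F `|` \bigcup_(a in F) [set b | exists i, g i a = b])).
    move=> a [xa U'a [b nU'b ab]]; apply: contrapT => /not_orP[nFa nFn].
    have nFb : ~ F b.
      move=> Fb; apply: nFn; exists b => //; apply: (open_edge_g fw).
      by rewrite (open_edge_sym fw).
    have xb : gcomp x b.
      by have [i <-] := open_edge_g fw ab; apply: gcomp_trans xa _; apply: gcomp_g.
    have [[y [Ay aS bS]]|sep] := pselect (exists y, [/\ A y, a \in S y & b \in S y]).
      by apply: nU'b; rewrite (U'in y) // -(U'in y a).
    have gab : open_edge glue_weight a b.
      rewrite /open_edge; have [->//|[y [Ay _ aS bS]]] := glue_cases a b.
      by case: sep; exists y.
    have gba : open_edge glue_weight b a by rewrite (open_edge_sym glue_fm).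
    apply: nU'b; apply/(crossing b a) => //.
      by move=> y Ay bS; apply/negP => aS; apply: sep; exists y.
    have Ua : U a.
      apply/(crossing a b) => //.
      by move=> y Ay aS; apply/negP => bS; apply: sep; exists y.
    apply: contrapT => nUb; apply: nFa; left; split=> //; by exists b.
  by rewrite finite_setU.
have [fin|fin] := ow x U' finB'.
- left; apply: (@sub_finite_set _ _ (F `|` [set a | [/\ gcomp x a, in_infinite w a & U' a]])).
    move=> a [xa ia Ua]; have [Fa|nFa] := pselect (F a); [by left|right].
    by split=> //; [exact: in_infinite_unglue|apply/infU].
  by rewrite finite_setU.
- right; apply: (@sub_finite_set _ _ (F `|` [set a | [/\ gcomp x a, in_infinite w a & ~ U' a]])).
    move=> a [xa ia Ua]; have [Fa|nFa] := pselect (F a); [by left|right].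
    by split=> //; [exact: in_infinite_unglue|move=> /(infU a ia xa nFa)].
  by rewrite finite_setU.
Qed.

End Glue.

End Weights.

(** * The initial weight *)

Section TwoColoring.
Variables (X : choiceType) (E : set (X * X)).
Hypotheses (sgE : simple_graph E) (bipE : bipartite E).

Lemma adjP x y : adj E x y <-> E (x, y).
Proof. by split=> [/set_mem|/mem_set]. Qed.

Lemma adj_sym x y : adj E x y = adj E y x.
Proof. by apply/idP/idP => /adjP/sgE.2/adjP. Qed.

(** Strong induction on the length: at a repeated vertex the walk splits into two shorter closed
    walks, and without one it is a cycle. *)
Lemma closed_walk_even p x : path (adj E) x p -> last x p = x -> ~~ odd (size p).
Proof.
have [n] := ubnP (size p); elim: n p x => // n IH p x.
rewrite ltnS => pn xp px; case/lastP: p => [//|q y] in pn xp px *.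
rewrite last_rcons in px; subst y.
have [uq|] := boolP (uniq (x :: q)).
  have [sq|sq] := ltnP 2 (size (x :: q)).
    by rewrite size_rcons; apply: (bipE sq); rewrite /ucycle /= xp.
  (* On at most two vertices, a walk of length one would be a loop and one of length two is even. *)
  rewrite size_rcons; case: q sq xp {pn uq} => [|y [|//]] //= _.
  by move=> /andP[/adjP/sgE.1].
move=> /(uniqPn x)[i [j [ij js nij]]].
set p := rcons q x in pn xp *.
have js' : (j < size p)%N by rewrite size_rcons.
have lastE k : (k < size p)%N -> last x (take k p) = nth x (x :: q) k.
  move=> kp; rewrite (last_nth x) size_take kp -[x :: take k p]/(take k.+1 (x :: p)).
  rewrite nth_take // /p -rcons_cons nth_rcons /=.
  by rewrite size_rcons in kp; rewrite kp.
have ip := ltn_trans ij js'.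
pose p1 := take i p; pose p2 := drop i (take j p); pose p3 := drop j p.
have p12 : p1 ++ p2 = take j p.
  by rewrite /p1 /p2 -(take_takel p (ltnW ij)) cat_take_drop.
have pE : p = (p1 ++ p2) ++ p3 by rewrite p12 cat_take_drop.
have l12 : last x (p1 ++ p2) = last x p1 by rewrite p12 /p1 !lastE.
move: (xp); rewrite pE !cat_path l12 => /andP[/andP[xp1 xp2] xp3].
have s1 : size p1 = i by rewrite size_take ip.
have s2 : size p2 = (j - i)%N by rewrite size_drop size_take js'.
have s3 : size p3 = (size p - j)%N by rewrite size_drop.
have lp : last x p = x by rewrite last_rcons.
have e2 : ~~ odd (size p2).
  apply: (IH p2 (last x p1)) => //; last by rewrite -last_cat.
  by rewrite s2; lia.
have e13 : ~~ odd (size (p1 ++ p3)).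
  apply: (IH _ x); first by rewrite size_cat s1 s3; lia.
    by rewrite cat_path xp1.
  by rewrite last_cat -l12 -last_cat -pE.
move: e2 e13; rewrite !size_cat !oddD; do 3 case: (odd _) => //.
Qed.

Lemma walk_rev p x : path (adj E) x p ->
  exists q, [/\ path (adj E) (last x p) q, last (last x p) q = x & size q = size p].
Proof.
elim: p x => [|y p IH] x /=; first by exists [::].
move=> /andP[xy /IH[q [yq qy sq]]]; exists (rcons q x); split.
- by rewrite rcons_path yq qy adj_sym.
- by rewrite last_rcons.
- by rewrite size_rcons sq.
Qed.

(** The colour is the parity of a walk from a chosen root of the component, well defined because
    closed walks are even. *)
Lemma two_coloring : exists chi : X -> bool,
  forall x y, E (x, y) -> chi y = ~~ chi x.
Proof.
(* Adjacent vertices have equal reachable sets, hence equal roots; these sets are nonempty, so the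
   differing defaults of [xget] do not show. *)
pose root x := xget x (reach (adj E) x).
have rootP x : reach (adj E) x (root x) by apply: (@xgetPex _ x); exists x; exact: reach_refl.
have root_eq x y : E (x, y) -> root x = root y.
  move=> Exy; have xy : adj E x y by apply/adjP.
  have es := adj_sym.
  rewrite /root (_ : reach (adj E) x = reach (adj E) y).
    by rewrite /xget; case: pselect => // -[]; exists y; apply/asboolP; exact: reach_refl.
  apply/seteqP; split=> z.
    by apply: reach_trans; apply: reach1; rewrite es.
  by apply: reach_trans; apply: reach1.
pose odd_walk x := exists p, [/\ path (adj E) (root x) p, last (root x) p = x & odd (size p)].
exists (fun x => `[< odd_walk x >]) => x y Exy.
have xy : adj E x y by apply/adjP.
have walk_y p : path (adj E) (root x) p -> last (root x) p = x ->
    path (adj E) (root y) (rcons p y) /\ last (root y) (rcons p y) = y.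
  by move=> xp px; rewrite -(root_eq x y Exy) rcons_path xp px last_rcons.
apply/asboolP/negP => [[q [yq qy oq]] /asboolP[p [xp px op]]|].
  have [yp py] := walk_y p xp px; have [q' [yq' qy' sq']] := walk_rev yq.
  rewrite qy in yq' qy'.
  have : ~~ odd (size (rcons p y ++ q')).
    apply: (@closed_walk_even _ (root y)); first by rewrite cat_path yp py.
    by rewrite last_cat py.
  by rewrite size_cat size_rcons sq' oddD /= op oq.
move=> nox; have [p xp px] : reach (adj E) (root x) x.
  by apply: reach_sym (rootP x); exact: adj_sym.
have [yp py] := walk_y p xp px; exists (rcons p y); split=> //.
rewrite size_rcons /=; apply/negP => op; by apply: nox; apply/asboolP; exists p.
Qed.

End TwoColoring.

Section InitialWeight.
Variables (X : choiceType) (d : nat) (g : 'I_d -> X -> X) (E : set (X * X)).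
Hypothesis sgE : simple_graph E.
Hypothesis gE : forall x y, E (x, y) <-> exists i, g i x = y.

Definition unit_weight : weight X := fun x y => if adj E x y then 1%R else 0%R.

Lemma unit_fm : (0 < d)%N -> fractional_matching g unit_weight.
Proof.
move=> d0; split.
- by move=> x y; rewrite /unit_weight (adj_sym sgE).
- by move=> x y; rewrite /unit_weight; case: ifP.
- by move=> x y; rewrite /unit_weight; case: ifP => _; lia.
- by move=> x y; rewrite /unit_weight; case: ifP => // /adjP/gE.
- move=> x; rewrite (eq_bigr (fun=> 1%R)); last first.
    by move=> i _; rewrite /unit_weight (_ : adj E x (g i x)) //; apply/adjP/gE; exists i.
  by rewrite sumr_const card_ord natz.
Qed.

(** For [d] at least 2 every edge is open. Removing the finite boundary of [U] leaves one infinite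
    piece, which lies on one side; the other side consists of finite pieces, each touching one of
    the finitely many neighbours of the boundary. *)
Lemma unit_ends_ok : one_ended E -> ends_ok g unit_weight.
Proof.
move=> oE x U finB.
have [d2|d2] := leqP d 1.
  (* For [d] at most 1 no integer weight lies strictly between 0 and [d] on an edge, so nothing is
     in an infinite open component. *)
  left; apply: (@sub_finite_set _ _ set0) => [a [_ ia _]|]; last exact: finite_set0.
  exfalso; apply: ia; apply: (sub_finite_set _ (finite_set1 a)) => b.
  apply: (reach_closed (T := [set a])) => // u v _.
  rewrite /open_edge /unit_weight; case: adj; rewrite ?ltxx //; lia.
have oe u v : open_edge d unit_weight u v = adj E u v.
  by rewrite /open_edge /unit_weight; case: adj; rewrite ?ltxx //; lia.
have ccE y z : gcomp g y z <-> component_of E y z.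
  split=> [[u <-]|[p yp <-]].
    elim: u y => [|i u IH] y; first by exists [::].
    apply: (@reach_trans _ (adj E) (g i y)); last exact: IH.
    by apply: reach1; apply/adjP/gE; exists i.
  apply: (@reach_closed _ (adj E) (gcomp g y) y); [|exact: gcomp_refl|by exists p].
  move=> u v yu /adjP/gE[i <-]; apply: gcomp_trans yu _; exact: gcomp_g.
set F := inner_boundary _ _ _ _ in finB.
have FC : F `<=` component_of E x by move=> a [/ccE].
have cx : components setT E (component_of E x).
  exists x => //; congr component_of.
  by rewrite /induced_edges setXTT setIT.
have [D [[cD iD] uD]] := oE _ cx F finB FC.
set V0 := _ `\` _ in cD uD; set e' := adj (induced_edges V0 E).
have e'P u v : e' u v <-> [/\ E (u, v), V0 u & V0 v].
  by split=> [/set_mem[/= ? []]|[? ? ?]] //; apply/mem_set.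
have e's u v : e' u v = e' v u.
  by apply/idP/idP => /e'P[uv u0 v0]; apply/e'P; split=> //; apply: sgE.2.
have e'U u v : e' u v -> U u -> U v.
  move=> /e'P[uv [xu nFu] _] Uu; apply: contrapT => nUv; apply: nFu; split=> //.
    exact/ccE.
  by exists v => //; rewrite oe; apply/adjP.
have [z z0 zD] := cD.
(* The point [z] represents the infinite piece [D], so [V] meets only finite pieces; [main] serves
   for [U] or for its complement. *)
have main (V : set X) : (forall u v, e' u v -> V u -> V v) -> ~ V z ->
    finite_set [set a | gcomp g x a /\ V a].
  move=> cV nVz; have es := adj_sym sgE.
  have nbF a : gcomp g x a -> V a -> ~ F a -> exists u, [/\ reach e' u a,
      exists2 v, F v & E (v, u) & finite_set (reach e' u)].
    move=> xa Va nFa; have a0 : V0 a by split=> //; apply/ccE.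
    have naz : ~ reach e' a z.
      by move=> az; apply: nVz; exact: reach_closed (fun u v Vu uv => cV u v uv Vu) Va az.
    have finr b : reach e' a b -> finite_set (reach e' b).
      move=> ab; apply: contrapT => inf; apply: naz.
      have b0 : V0 b.
        by apply: (reach_closed (T := V0)) ab => // u v _ /e'P[].
      have DE : D = reach e' b by apply: uD; split=> //; exists b.
      by apply: reach_trans ab _; rewrite -DE -zD; exact: reach_refl.
    (* A walk in the component from [a] to [z] must leave the piece of [a], and it can only do so
       into [F]. *)
    have [u au [v [uv nav]]] : exists2 u, reach e' a u &
        exists v, E (u, v) /\ ~ reach e' a v.
      apply: contrapT => H; apply: naz.
      apply: (reach_closed (T := reach e' a) (e := adj E) (x := a)).
      + move=> u v au /adjP uv; apply: contrapT => nav; apply: H.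
        by exists u => //; exists v.
      + exact: reach_refl.
      + apply: (@reach_trans _ _ x); last by case: z0.
        by apply: reach_sym; [exact: es|apply/ccE].
    have u0 : V0 u by apply: (reach_closed (T := V0)) au => // u' v' _ /e'P[].
    exists u; split; [exact: reach_sym au| |exact: finr].
    exists v; last exact: sgE.2.
    apply: contrapT => nFv; apply: nav; apply: reach_trans au _; apply: reach1.
    apply/e'P; split=> //; split=> //; apply/ccE.
    apply: (@gcomp_trans _ _ _ u); first by apply/ccE; case: u0.
    by have [i <-] := (gE u v).1 uv; exact: gcomp_g.
  pose N := \bigcup_(v in F) [set u | E (v, u)].
  have finN : finite_set N.
    apply: bigcup_finite => // v _.
    apply: sub_finite_set (finite_seq [seq g i v | i <- enum 'I_d]) => u /gE[i <-] /=.
    by apply/mapP; exists i => //; rewrite mem_enum.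
  apply: (@sub_finite_set _ _ (F `|` \bigcup_(u in N) [set a | reach e' u a /\ finite_set (reach e' u)])).
    move=> a [xa Va]; have [Fa|nFa] := pselect (F a); [by left|right].
    by have [u [ua [v Fv vu] fu]] := nbF a xa Va nFa; exists u => //; exists v.
  rewrite finite_setU; split=> //; apply: bigcup_finite => // u _.
  have [fu|nfu] := pselect (finite_set (reach e' u)).
    by apply: sub_finite_set fu => a [].
  by apply: (@sub_finite_set _ _ set0) => [a [_ /nfu]|].
have [Uz|nUz] := pselect (U z); [right|left].
  apply: sub_finite_set (main (~` U) _ _) => [a [? _ ?]|u v uv nUu Uv|] //.
  by apply: nUu; apply: e'U Uv; rewrite e's.
by apply: sub_finite_set (main U e'U nUz) => a [].
Qed.

End InitialWeight.

(** * Borel codes for finite changes *)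

Section BorelFunctions.
Context {T : topologicalType}.

(** For countable [I] this is Borel measurability into a discrete space. *)
Definition borel_fun (I : Type) (F : T -> I) := forall i, borel [set x | F x = i].

Lemma borel_fun_pred (I : countType) (F : T -> I) (P : I -> Prop) :
  borel_fun F -> borel [set x | P (F x)].
Proof.
move=> bF; rewrite (_ : [set x | _] = [set x | exists i, P i /\ F x = i]).
  by apply: borel_ex => i; apply: borel_and => //; exact: borel_const.
by apply/seteqP; split=> [x Px|x /= [i [Pi ->]]] //; exists (F x).
Qed.

Lemma borel_fun_map2 (I J K : countType) (F : T -> I) (G : T -> J) (h : I -> J -> K) :
  borel_fun F -> borel_fun G -> borel_fun (fun x => h (F x) (G x)).
Proof.
move=> bF bG k.
rewrite (_ : [set x | _] = [set x | exists i, F x = i /\ h i (G x) = k]).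
  by apply: borel_ex => i; apply: borel_and => //; exact: (borel_fun_pred (fun j => h i j = k) bG).
by apply/seteqP; split=> [x Px|x /= [i [<-]]] //; exists (F x).
Qed.

Lemma borel_fun_eq (I : countType) (F G : T -> I) :
  borel_fun F -> borel_fun G -> borel [set x | F x = G x].
Proof.
move=> bF bG; rewrite (_ : [set x | _] = [set x | exists i, F x = i /\ G x = i]).
  by apply: borel_ex => i; apply: borel_and.
by apply/seteqP; split=> [x /= ->|x /= [i [-> ->]]] //; exists (G x).
Qed.

Lemma borel_fun_const (I : Type) (i : I) : borel_fun (fun _ : T => i).
Proof. by move=> j; apply: borel_const. Qed.

Lemma borel_fun_sum (I : Type) (r : seq I) (F : I -> T -> int) :
  (forall i, borel_fun (F i)) -> borel_fun (fun x => \sum_(i <- r) F i x)%R.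
Proof.
move=> bF; elim: r => [|i r IH].
  rewrite (_ : (fun x => _) = fun=> 0%R); first exact: borel_fun_const.
  by apply/funext => x; rewrite big_nil.
rewrite (_ : (fun x => _) = fun x => (F i x + \sum_(j <- r) F j x)%R).
  exact: borel_fun_map2.
by apply/funext => x; rewrite big_cons.
Qed.

End BorelFunctions.

Section Codes.
Variables (X : topologicalType) (d : nat) (g : 'I_d -> X -> X) (chi : X -> bool).
Variables (U : nat -> set X).
Hypothesis hX : hausdorff_space X.
Hypothesis bU : open_base U.
Hypothesis bg : forall i A, borel A -> borel (g i @^-1` A).
Hypothesis g_inj : forall x, injective (g^~ x).
Hypothesis g_sym : forall x i, exists j, g j (g i x) = x.
Hypothesis chi_g : forall x i, chi (g i x) = ~~ chi x.

Local Notation word := (seq 'I_d).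
Local Notation walk := (walk g).

Lemma borel_walk (u : word) (P : X -> Prop) : borel [set x | P x] -> borel [set x | P (walk u x)].
Proof.
elim: u P => [|i u IH] P bP //.
exact: (bg (A := [set x | P (walk u x)]) i (IH _ bP)).
Qed.

Lemma base_eq x y : (forall j, U j x <-> U j y) -> x = y.
Proof.
move=> H; apply: contrapT => /(hausdorff_separate hX)[V [W [oV _ Vx Wy VW]]].
have [j [Ux UV]] := bU.2 _ _ oV Vx.
have : (V `&` W) y by split=> //; apply/UV/(H j).1.
by rewrite VW.
Qed.

Lemma borel_base j : borel [set x | U j x].
Proof. by apply: borel_open; apply: bU.1. Qed.

(** Two points are equal when they lie in the same basic open sets, a countable condition. *)
Lemma borel_eq_walk (u v : word) : borel [set x | walk u x = walk v x].
Proof.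
rewrite (_ : [set x | _] = [set x | forall j, (U j (walk u x) -> U j (walk v x)) /\
   (U j (walk v x) -> U j (walk u x))]).
  by apply: borel_all => j; apply: borel_and; apply: borel_imp;
    apply: borel_walk; apply: borel_base.
apply/seteqP; split=> [x /= -> //|x /= H]; apply: base_eq => j.
by split; case: (H j).
Qed.

(** Borelness is asked for along pairs of points named by words from a common [x], which reaches
    every pair within one component. *)
Definition borel_weight (w : weight X) :=
  forall u v, borel_fun (fun x => w (walk u x) (walk v x)).

Definition points (s : seq word) (y : X) : seq X := [seq walk u y | u <- s].

(** Words naming [S], words naming [W], and a table of new weights, all relative to a base point;
    hence countably many codes. *)
Definition code := (seq word * seq word * seq (word * word * int))%type.

Fixpoint update (w : weight X) (c : seq (word * word * int)) (y a b : X) : int :=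
  if c is (u, v, k) :: c' then
    if (walk u y == a) && (walk v y == b) then k else update w c' y a b
  else w a b.

Lemma borel_mem_points (s : seq word) (t u : word) :
  borel [set x | walk u x \in points s (walk t x)].
Proof.
rewrite (_ : [set x | _] = [set x | exists v, v \in s /\ walk (t ++ v) x = walk u x]).
  by apply: borel_ex => v; apply: borel_and; [exact: borel_const|exact: borel_eq_walk].
apply/seteqP; split=> x /=.
  by move=> /mapP[v vs ->]; exists v; rewrite walk_cat.
by move=> [v [vs <-]]; rewrite walk_cat; apply: map_f.
Qed.

Lemma borel_update w c (t u v : word) : borel_weight w ->
  borel_fun (fun x => update w c (walk t x) (walk u x) (walk v x)).
Proof.
move=> bw; elim: c => [|[[u' v'] k'] c IH] //= k.
rewrite (_ : [set x | _] = [set x |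
   ((walk (t ++ u') x = walk u x /\ walk (t ++ v') x = walk v x) /\ k' = k) \/
   (~ (walk (t ++ u') x = walk u x /\ walk (t ++ v') x = walk v x) /\
    update w c (walk t x) (walk u x) (walk v x) = k)]).
  by apply: borel_or; apply: borel_and; [|exact: borel_const|apply: borel_not|exact: IH];
    apply: borel_and; exact: borel_eq_walk.
apply/seteqP; split=> x /=; rewrite !walk_cat.
  case: ifP => [/andP[/eqP -> /eqP ->]|/negP n] ?; [by left|right].
  by split=> // -[e1 e2]; apply: n; rewrite e1 e2 !eqxx.
case=> [[[-> ->] <-]|[n <-]]; first by rewrite !eqxx.
by case: ifP => // /andP[/eqP e1 /eqP e2]; case: n.
Qed.

Lemma update_out w c y a b : ~ (gcomp g y a /\ gcomp g y b) -> update w c y a b = w a b.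
Proof.
move=> nab; elim: c => [|[[u v] k] c IH] //=.
by case: ifP => // /andP[/eqP ua /eqP vb]; case: nab; split; [exists u|exists v].
Qed.

Lemma points_gcomp s y z : z \in points s y -> gcomp g y z.
Proof. by move=> /mapP[u _ ->]; exists u. Qed.

Record valid (w : weight X) (i : 'I_d) (c : code) (y : X) : Prop := {
  va_fm : fractional_matching g (update w c.2 y);
  va_changes : changes_in d w (update w c.2 y) (points c.1.1 y);
  va_frame : frame d (update w c.2 y) (points c.1.1 y) (points c.1.2 y);
  va_integral : ~~ open_edge d (update w c.2 y) y (g i y) }.

(** The change from [integrate_edge] and a frame around it involve only finitely many vertices of
    the component of [y], and words name these. *)
Lemma valid_exists w i y : fractional_matching g w -> ends_ok g w ->
  exists c, valid w i c y.
Proof.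
move=> fw ow.
have [w' [Z [fw' ch int Zy]]] := integrate_edge g_inj g_sym chi_g y i fw ow.
have ow' : ends_ok g w' := ends_ok_changes fw ch ow.
have [S [W [fr ZS Sy]]] := frame_exists g_sym fw' ow' Zy.
have words (s : seq X) : (forall z, z \in s -> gcomp g y z) -> exists r, points r y = s.
  elim: s => [|z s IH] H; first by exists [::].
  have [u uz] := H z (mem_head _ _).
  have [|r rs] := IH; first by move=> z' zs; apply: H; rewrite inE zs orbT.
  by exists (u :: r); rewrite /points /= uz -rs.
have [s sS] := words S Sy.
have [t tW] := words W (fun z zW => Sy z (fr_sub fr zW)).
(* The table lists [w'] on all pairs from [S]; elsewhere [w'] equals [w]. *)
pose c := [seq (p.1, p.2, w' (walk p.1 y) (walk p.2 y)) | p <- [seq (u, v) | u <- s, v <- s]].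
suff E : update w c y = w' by exists (s, t, c); split; rewrite /= ?E ?sS ?tW // => u v /ch[/ZS ? /ZS ?].
apply/funext => a; apply/funext => b.
have [in_c|nin] := pselect (exists u v, [/\ (u, v) \in [seq (u, v) | u <- s, v <- s],
    walk u y = a & walk v y = b]).
  move: in_c; rewrite /c; elim: [seq (u, v) | u <- s, v <- s] => [|[u v] r IH] /=.
    by case=> u [v []].
  move=> [u' [v' [uv' ua vb]]]; case: ifP => [/andP[/eqP -> /eqP ->]//|n].
  apply: IH; exists u', v'; split=> //; move: uv'; rewrite inE => /orP[/eqP[eu ev]|//].
  by rewrite -eu -ev ua vb !eqxx in n.
have -> : update w c y a b = w a b.
  move: nin; rewrite /c; elim: [seq (u, v) | u <- s, v <- s] => [|[u v] r IH] //= nin.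
  case: ifP => [/andP[/eqP ua /eqP vb]|_].
    by case: nin; exists u, v; rewrite mem_head.
  by apply: IH => -[u' [v' [uv ? ?]]]; apply: nin; exists u', v'; rewrite inE uv orbT.
apply: contrapT => ne; apply: nin.
have [aZ bZ _] := ch a b (nesym ne).
have := ZS _ aZ; have := ZS _ bZ; rewrite -sS => /mapP[v vs vb] /mapP[u us ua].
by exists u, v; split=> //; apply/allpairsP; exists (u, v).
Qed.

(** Vertices are replaced by words, so that all quantifiers become countable; pairs not both in the
    component of [y] keep their weight from [w]. *)
Lemma borel_valid w i c : fractional_matching g w -> borel_weight w -> borel [set y | valid w i c y].
Proof.
move=> fw bw; case: c => [[s t] c].
pose f u v y := update w c y (walk u y) (walk v y).
have bf u v : borel_fun (f u v) by exact: (@borel_update w c [::] u v bw).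
have bm r u : borel [set y | walk u y \in points r y] by exact: (@borel_mem_points r [::] u).
have bopen u v : borel [set y | open_edge d (update w c y) (walk u y) (walk v y)].
  exact: (borel_fun_pred (fun k : int => (0 < k < d%:Z)%R) (bf u v)).
have bwopen u v : borel [set y | open_edge d w (walk u y) (walk v y)].
  exact: (borel_fun_pred (fun k : int => (0 < k < d%:Z)%R) (bw u v)).
pose P1 y := forall u v, f u v y = f v u y.
pose P2 y := forall u v, (0 <= f u v y <= d%:Z)%R.
pose P3 y := forall u, (\sum_(j <- enum 'I_d) f u (rcons u j) y = d%:Z)%R.
pose P4 y := forall u v, f u v y = w (walk u y) (walk v y) \/
  (walk u y \in points s y /\ (walk v y \in points s y /\ open_edge d w (walk u y) (walk v y))).
pose P5 y := forall u, walk u y \in points t y -> walk u y \in points s y.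
(* The arbitrary set [T] in [fr_conn] matters only through its trace on the finite list of points of
   [s], so it suffices to quantify over lists [r] of words. *)
pose P6 y := forall r : seq word,
  (forall u v, walk u y \in points s y -> walk v y \in points s y ->
     walk u y \in points r y -> open_edge d (update w c y) (walk u y) (walk v y) ->
     walk v y \in points r y) ->
  forall u v, walk u y \in points t y -> walk v y \in points t y ->
     walk u y \in points r y -> walk v y \in points r y.
pose P7 y := forall u v, walk u y \in points s y -> ~ walk u y \in points t y ->
  open_edge d (update w c y) (walk u y) (walk v y) ->
  walk v y \in points s y /\ ~ walk v y \in points t y.
pose P8 y := ~ open_edge d (update w c y) (walk [::] y) (walk [:: i] y).
rewrite (_ : [set y | _] = [set y | P1 y /\ (P2 y /\ (P3 y /\ (P4 y /\ (P5 y /\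
    (P6 y /\ (P7 y /\ P8 y))))))]).
  apply: borel_and.
    apply: borel_all => u; apply: borel_all => v.
    exact: borel_fun_eq (bf u v) (bf v u).
  apply: borel_and.
    apply: borel_all => u; apply: borel_all => v.
    exact: (borel_fun_pred (fun k : int => (0 <= k <= d%:Z)%R) (bf u v)).
  apply: borel_and.
    apply: borel_all => u.
    exact: (borel_fun_sum (enum 'I_d) (fun j => bf u (rcons u j)) (Posz d)).
  apply: borel_and.
    apply: borel_all => u; apply: borel_all => v; apply: borel_or.
      exact: borel_fun_eq (bf u v) (bw u v).
    by do !apply: borel_and.
  apply: borel_and; first by apply: borel_all => u; apply: borel_imp.
  apply: borel_and.
    apply: borel_all => r; apply: borel_imp; apply: borel_all => u; apply: borel_all => v;
    by do !apply: borel_imp.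
  apply: borel_and; last by apply: borel_not.
  apply: borel_all => u; apply: borel_all => v; apply: borel_imp => //.
  apply: borel_imp; first exact: borel_not.
  by apply: borel_imp => //; apply: borel_and => //; apply: borel_not.
apply/seteqP; split=> y /=.
  move=> [[f1 f2 f3 f4 f5] ch [r1 r2 r3] int]; split; last split; last split; last split;
    last split; last split; last split.
  - by move=> u v; apply: f1.
  - by move=> u v; rewrite /f f2 f3.
  - move=> u; rewrite -[RHS](f5 (walk u y)) -[in RHS]big_enum /=; apply: eq_bigr => j _.
    by rewrite /f -cats1 walk_cat.
  - move=> u v; have [|ne] := pselect (f u v y = w (walk u y) (walk v y)); [by left|right].
    by have [] := ch _ _ ne.
  - by move=> u; apply: r1.
  - move=> r cr u v ut vt ur.
    apply: (r2 [set` points r y] _ (walk u y)) => // a b aS bS /=.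
    have [u' u'a] := points_gcomp aS; have [v' v'b] := points_gcomp bS.
    by rewrite -u'a -v'b in aS bS *; apply: cr.
  - by move=> u v us /negP ut uv; have [? /negP ?] := r3 _ _ us ut uv.
  - by move/negP: int.
move=> [p1 [p2 [p3 [p4 [p5 [p6 [p7 p8]]]]]]].
have ch : changes_in d w (update w c y) (points s y).
  move=> a b ne; have [[[u ua] [v vb]]|nab] := pselect (gcomp g y a /\ gcomp g y b); last first.
    by case: ne; apply: update_out.
  by have [] := p4 u v; rewrite /f ua vb // => -[? []].
split=> //=; last by apply/negP.
- have bnd a b : (0 <= update w c y a b <= d%:Z)%R.
    have [[[u <-] [v <-]]|nab] := pselect (gcomp g y a /\ gcomp g y b); first exact: p2.
    by rewrite update_out // (fm_ge0 fw) (fm_le fw).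
  split.
  + move=> a b; have [[[u <-] [v <-]]|nab] := pselect (gcomp g y a /\ gcomp g y b); first exact: p1.
    rewrite !update_out //; first exact: fm_sym fw _ _.
    by move=> [? ?]; apply: nab.
  + by move=> a b; case/andP: (bnd a b).
  + by move=> a b; case/andP: (bnd a b).
  + move=> a b nz; have [eq|ne] := pselect (update w c y a b = w a b).
      by apply: (fm_edge fw); rewrite -eq.
    by apply: (open_edge_g fw); have [] := ch a b ne.
  + move=> a; have [[u <-]|na] := pselect (gcomp g y a).
      rewrite -[RHS](p3 u) big_enum /=; apply: eq_bigr => j _.
      by rewrite /f -cats1 walk_cat.
    rewrite -(fm_sum fw a); apply: eq_bigr => j _; apply: update_out.
    by case.
- split.
  + by move=> a aT; have [u ua] := points_gcomp aT; rewrite -ua in aT *; apply: p5.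
  + move=> T cT a b aT bT Ta.
    pose r := [seq u <- s | `[< T (walk u y) >]].
    have rP z : z \in points r y <-> z \in points s y /\ T z.
      split=> [/mapP[u]|[/mapP[u us ->] Tu]].
        by rewrite mem_filter => /andP[/asboolP Tu us] ->; split=> //; apply: map_f.
      by apply: map_f; rewrite mem_filter us andbT; apply/asboolP.
    have [u ua] := points_gcomp aT; have [v vb] := points_gcomp bT.
    suff /rP[_] : b \in points r y by [].
    rewrite -vb; apply: (p6 r _ u v); rewrite ?ua ?vb //.
      move=> u' v' us vs /rP[_ Tu] uv; apply/rP; split=> //.
      exact: cT Tu uv.
    by apply/rP; split=> //; rewrite -ua; apply: p5; rewrite ua.
  + move=> a b aS aT ab; have [u ua] := points_gcomp aS.
    have [v vb] : gcomp g y b.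
      have /(open_edge_g fw)[j <-] : open_edge d w a b.
        exact: changes_open_edge ch _ _ ab.
      by apply: gcomp_trans (points_gcomp aS) _; apply: gcomp_g.
    rewrite -ua -vb in aS aT ab *; have [|? /negP ?] := p7 u v aS _ ab.
      exact/negP.
    by [].
Qed.

(** * Sparse Borel sets and one stage of the construction *)

Definition sparse (N j : nat) : set X :=
  [set x | U j x /\ forall v : word, (size v <= N)%N -> walk v x <> x -> ~ U j (walk v x)].

Lemma borel_sparse N j : borel (sparse N j).
Proof.
apply: borel_and; first exact: borel_base.
apply: borel_all => v; apply: borel_imp; first exact: borel_const.
apply: borel_imp; first by apply: borel_not; exact: (borel_eq_walk v [::]).
by apply: borel_not; apply: borel_walk; exact: borel_base.
Qed.

Lemma finite_words N : finite_set [set v : word | (size v <= N)%N].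
Proof.
elim: N => [|N IH].
  by apply: sub_finite_set (finite_set1 [::]) => -[].
apply: (@sub_finite_set _ _ ([set [::]] `|` \bigcup_(i in [set: 'I_d])
    [set i :: v | v in [set v : word | (size v <= N)%N]])).
  by move=> [|i v] /= sv; [left|right; exists i => //; exists v].
rewrite finite_setU; split; first exact: finite_set1.
by apply: bigcup_finite => [|i _]; [exact: finite_finset|exact: finite_image].
Qed.

(** Only finitely many points are within [N] steps of [x], so some basic set containing [x] avoids
    the others. *)
Lemma sparse_cover N x : exists j, sparse N j x.
Proof.
pose F := [set walk v x | v in [set v : word | (size v <= N)%N]] `\` [set x].
have oF : open (~` F).
  apply: closed_openC; apply: accessible_finite_set_closed.1.
    exact: hausdorff_accessible.
  by apply: finite_setD; apply: finite_image; exact: finite_words.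
have [|j [Ux UF]] := bU.2 _ x oF; first by case=> _ /(_ erefl).
exists j; split=> // v vN vx /UF; apply; split=> //.
by exists v.
Qed.

(** A common point within [N] steps of both [x] and [y] gives a walk of length at most [N + N]
    between them. *)
Lemma sparse_disjoint (s : seq word) N j x y z : (forall u, u \in s -> (size u <= N)%N) ->
  sparse (N + N) j x -> sparse (N + N) j y ->
  z \in points s x -> z \in points s y -> x = y.
Proof.
move=> sN [Ux Hx] [Uy _] /mapP[u us ->] /mapP[u' us' uu'].
have [v sv vK] := walk_back g_sym u' y.
have xy : walk (u ++ v) x = y by rewrite walk_cat uu' vK.
apply: contrapT => nxy; apply: (Hx (u ++ v)); rewrite ?xy //; last exact: nesym.
by rewrite size_cat sv leq_add // sN.
Qed.

Record admissible (w : weight X) : Prop := {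
  ad_fm : fractional_matching g w;
  ad_ends : ends_ok g w;
  ad_borel : borel_weight w }.

(** Countably many stages, each a code with a sparse set, cover all possible positions of
    [walk k x]. For one of them the matching part of [U j] is nonmeagre, and its code is applied at
    all its points at once. *)
Lemma admissible_step w (k : word) (i : 'I_d) (j : nat) : admissible w ->
  exists w', [/\ admissible w', forall u v, w' u v <> w u v -> open_edge d w u v &
    ~ meagre (U j) ->
    ~ meagre (U j `&` [set x | ~ open_edge d w' (walk k x) (g i (walk k x))])].
Proof.
move=> [fw ow bw]; have [mU|nmU] := pselect (meagre (U j)); first by exists w; split.
pose size_bound (c : code) := \max_(u <- c.1.1) size u.
pose stage (cl : code * nat) : set X := [set y | valid w i cl.1 y /\
  sparse (size_bound cl.1 + size_bound cl.1) cl.2 y].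
have [cl Hcl] : exists cl, ~ meagre [set x | U j x /\ stage cl (walk k x)].
  apply: contrapT => H; apply: nmU.
  apply: (@meagre_sub _ _ [set x | exists cl, U j x /\ stage cl (walk k x)]).
    move=> x Ux; have [c vc] := valid_exists i (walk k x) fw ow.
    have [l sl] := sparse_cover (size_bound c + size_bound c) (walk k x).
    by exists (c, l).
  by apply: meagre_ex => cl; apply: contrapT => ncl; apply: H; exists cl.
case: cl Hcl => c l Hcl; set A := stage (c, l) in Hcl.
pose S := points c.1.1; pose w2 y := update w c.2 y.
have fw2 y : A y -> fractional_matching g (w2 y) by case=> -[].
have ch2 y : A y -> changes_in d w (w2 y) (S y) by case=> -[].
have fr2 y : A y -> frame d (w2 y) (S y) (points c.1.2 y) by case=> -[].
have Scc y z : A y -> z \in S y -> gcomp g y z by move=> _; exact: points_gcomp.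
have disj x y z : A x -> A y -> z \in S x -> z \in S y -> x = y.
  move=> [_ sx] [_ sy]; apply: sparse_disjoint sx sy => u us.
  exact: (leq_bigmax_seq (F := fun u => size u)).
exists (glue_weight w A S w2); split.
- split.
  + exact: glue_fm fw fw2 ch2 disj.
  + exact: (glue_ends_ok g_sym fw fw2 ch2 Scc disj fr2 ow).
  + move=> u v m.
    (* The base point responsible for [walk u x] lies in the component of [x], so it is found among
       the countably many [walk t x]. *)
    pose at_ t x := A (walk t x) /\ walk u x \in S (walk t x).
    have bat t : borel [set x | at_ t x].
      apply: borel_and; last exact: borel_mem_points.
      apply: borel_walk; apply: borel_and; last exact: borel_sparse.
      exact: borel_valid.
    rewrite (_ : [set x | _] = [set x |
      (exists t, at_ t x /\ w2 (walk t x) (walk u x) (walk v x) = m) \/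
      ((forall t, ~ at_ t x) /\ w (walk u x) (walk v x) = m)]).
      apply: borel_or; first by apply: borel_ex => t; apply: borel_and => //; exact: borel_update.
      apply: borel_and; last exact: bw.
      by apply: borel_all => t; apply: borel_not.
    apply/seteqP; split=> x /=.
      have [[t [At St]]|nat_] := pselect (exists t, at_ t x).
        by rewrite (glue_l w w2 disj _ At St) => <-; left; exists t.
      rewrite glue_out => [<-|y Ay].
        by right; split=> // t ?; apply: nat_; exists t.
      apply/negP => uS; have [r ru] := Scc y _ Ay uS.
      have [r' _ rK] := walk_back g_sym r y; apply: nat_; exists (u ++ r').
      by rewrite /at_ walk_cat -ru rK ru.
    case=> [[t [[At St] <-]]|[nat_ <-]]; first exact: (glue_l w w2 disj).
    apply: glue_out => y Ay; apply/negP => uS; have [r ru] := Scc y _ Ay uS.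
    have [r' _ rK] := walk_back g_sym r y; apply: (nat_ (u ++ r')).
    by rewrite /at_ walk_cat -ru rK ru.
- by move=> u v; exact: (glue_changes ch2 disj).
- move=> _; apply: contra_not Hcl; apply: meagre_sub => x [Ux Ax]; split=> //=.
  have [vx _] := Ax; apply/negP; have [_ _ fr int] := vx.
  (* If the base point is outside its own [S], the local change leaves its edges alone, so the edge
     was already closed in [w]. *)
  have [xS|xS] := boolP (walk k x \in S (walk k x)).
    by rewrite /open_edge (glue_l w w2 disj _ Ax xS).
  apply/negP => /(glue_open_edge ch2 disj); apply/negP.
  by rewrite /open_edge -(unchanged ch2 Ax (or_introl xS)).
Qed.

Lemma borel_open_edge w k i : borel_weight w ->
  borel [set x | open_edge d w (walk k x) (g i (walk k x))].
Proof.
move=> bw; have := borel_fun_pred (fun m : int => (0 < m < d%:Z)%R) (bw k (k ++ [:: i])).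
by under eq_set do rewrite walk_cat.
Qed.

(** * The generic sequence of weights and the limit matching *)

Lemma generic_sequence (w0 : weight X) : admissible w0 -> exists w : nat -> weight X,
  [/\ forall n, admissible (w n),
      forall n u v, w n.+1 u v <> w n u v -> open_edge d (w n) u v &
      forall k i, comeagre [set x | exists n, ~ open_edge d (w n) (walk k x) (g i (walk k x))]].
Proof.
move=> ad0; pose T := {w : weight X | admissible w}.
have /choice[nx Hnx] : forall ns : nat * T, exists s' : T,
    (forall u v, sval s' u v <> sval ns.2 u v -> open_edge d (sval ns.2) u v) /\
    (forall k i j, unpickle ns.1 = Some (k, i, j) -> ~ meagre (U j) ->
      ~ meagre (U j `&` [set x | ~ open_edge d (sval s') (walk k x) (g i (walk k x))])).
  move=> [n [w adw]] /=; case: (unpickle n) => [[[k i] j]|]; last first.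
    by exists (exist _ w adw).
  have [w' [adw' ch nm]] := admissible_step k i j adw.
  by exists (exist _ w' adw'); split=> // k' i' j' [<- <- <-].
pose st := fix st n : T := if n is n'.+1 then nx (n', st n') else exist _ w0 ad0.
exists (fun n => sval (st n)); split.
- by move=> n; case: (st n).
- by move=> n; case: (Hnx (n, st n)).
move=> k i; apply: (comeagre_of_base bU).
  apply: borel_ex => n; apply: borel_not.
  by apply: borel_open_edge; have [_ _ bw] := svalP (st n).
move=> j nmU; have [_ H] := Hnx (pickle (k, i, j), st (pickle (k, i, j))).
apply: contra_not (H k i j (pickleK _) nmU); apply: meagre_sub => x [Ux nx_]; split=> //.
by exists (pickle (k, i, j)).+1.
Qed.

Local Open Scope ring_scope.

Lemma generic_matching (E : set (X * X)) (w0 : weight X) : (0 < d)%N ->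
  (forall x y, E (x, y) <-> exists i, g i x = y) -> admissible w0 ->
  exists X' : set X, [/\ forall x i, X' x -> X' (g i x), comeagre X', borel X' &
    exists M : set (X * X), borel_perfect_matching X' E M].
Proof.
move=> d0 gE ad0; have [w [adw chw cow]] := generic_sequence ad0.
have fw n := ad_fm (adw n).
have stable n m u v : (n <= m)%N -> ~ open_edge d (w n) u v -> w m u v = w n u v.
  move=> nm nouv; elim: m nm => [|m IH]; first by rewrite leqn0 => /eqP ->.
  rewrite leq_eqVlt => /orP[/eqP <- //|]; rewrite ltnS => nm.
  apply: contrapT => ne; apply: nouv; rewrite /open_edge -(IH nm).
  by apply: chw; rewrite (IH nm).
pose P k i : set X := [set x | exists n, ~ open_edge d (w n) (walk k x) (g i (walk k x))].
pose X' : set X := [set x | forall ki : word * 'I_d, P ki.1 ki.2 x].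
have bP k i : borel (P k i).
  by apply: borel_ex => n; apply: borel_not; apply: borel_open_edge; have [_ _ bw] := adw n.
have bX' : borel X' by apply: borel_all => -[k i]; apply: bP.
have invX' x i : X' x -> X' (g i x).
  by move=> X'x [k i']; have := X'x (i :: k, i').
have conv x i : X' x -> exists n, ~ open_edge d (w n) x (g i x).
  by move=> X'x; exact: (X'x ([::], i)).
have w0d n x y : ~ open_edge d (w n) x y -> w n x y = 0 \/ w n x y = d%:Z.
  have := fm_ge0 (fw n) x y; have := fm_le (fw n) x y; rewrite /open_edge.
  move=> h1 h2 /negP; lia.
have nopen n x y : w n x y = d%:Z -> ~ open_edge d (w n) x y.
  by move=> e; rewrite /open_edge e ltxx andbF.
exists X'; split=> //.
  rewrite /comeagre (_ : ~` X' = [set x | exists ki : word * 'I_d, ~ P ki.1 ki.2 x]).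
    by apply: meagre_ex => -[k i]; apply: cow.
  apply/seteqP; split=> x /=; first by move=> /existsNP.
  by move=> [ki H] X'x; apply/H/X'x.
pose M : set (X * X) := [set xy | X' xy.1 /\ exists n, w n xy.1 xy.2 = d%:Z].
have dE : d%:Z <> 0 by lia.
have Mg x y : M (x, y) -> exists i, g i x = y.
  by move=> [_ [n /= wd]]; apply: (fm_edge (fw n)); rewrite wd.
exists M; split.
- rewrite (_ : M = [set xy | exists i, (forall j, (U j (g i xy.1) -> U j xy.2) /\
      (U j xy.2 -> U j (g i xy.1))) /\ (X' xy.1 /\ exists n, w n xy.1 (g i xy.1) = d%:Z)]).
    have pr1 (Q : set X) : borel Q -> borel [set xy : X * X | Q xy.1].
      by apply: borel_preimage; exact: fst_continuous.
    have pr2 (Q : set X) : borel Q -> borel [set xy : X * X | Q xy.2].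
      by apply: borel_preimage; exact: snd_continuous.
    apply: borel_ex => i; apply: borel_and.
      apply: borel_all => j; have b1 := pr1 _ (bg i (borel_base j)).
      have b2 := pr2 _ (borel_base j).
      by apply: borel_and; apply: borel_imp.
    apply: borel_and; first exact: pr1.
    apply: (pr1 [set x | exists n, w n x (g i x) = d%:Z]).
    apply: borel_ex => n; have [_ _ bw] := adw n.
    exact: (bw [::] [:: i] d%:Z).
  apply/seteqP; split=> [[x y] Mxy|[x y] /= [i [Uxy [X'x [n wn]]]]].
    have [i gi] := Mg x y Mxy; exists i => /=; by rewrite gi.
  have <- : g i x = y by apply: base_eq => j; split; case: (Uxy j).
  by split=> //; exists n.
- move=> [x y] Mxy; have [i gi] := Mg x y Mxy; have [X'x _] := Mxy.
  split; first by apply/gE; exists i.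
  by split=> //=; rewrite -gi; apply: invX'.
- move=> x y Mxy; have [i gi] := Mg x y Mxy; have [X'x [n wn]] := Mxy.
  by split=> /=; [rewrite -gi; apply: invX'|exists n; rewrite (fm_sym (fw n))].
move=> x X'x.
have /choice[N HN] : forall i, exists n, ~ open_edge d (w n) x (g i x) by move=> i; apply: conv.
pose n0 := \max_i N i.
have int i m : (n0 <= m)%N -> w m x (g i x) = w n0 x (g i x) /\
    (w n0 x (g i x) = 0 \/ w n0 x (g i x) = d%:Z).
  move=> nm; have Nn : (N i <= n0)%N by exact: leq_bigmax.
  rewrite !(stable (N i) _ _ _ _ (HN i)) //; last exact: leq_trans nm.
  by split=> //; apply: w0d.
have [i wi] : exists i, w n0 x (g i x) = d%:Z.
  apply: contrapT => H; apply: dE; rewrite -(fm_sum (fw n0) x) big1 // => i _.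
  have [_ [//|e]] := int i n0 (leqnn _).
  by case: H; exists i.
exists (g i x); split; first by split=> //; exists n0.
move=> y Mxy; have [i' gi'] := Mg x y Mxy; have [_ [m /= wm]] := Mxy.
rewrite -gi' in wm *.
have wm' : w n0 x (g i' x) = d%:Z.
  have e1 := stable m (maxn m n0) _ _ (leq_maxl _ _) (nopen _ _ _ wm).
  by rewrite -(int i' (maxn m n0) (leq_maxr _ _)).1 e1.
congr (g _ x); apply: contrapT => /eqP ii'.
have := fm_sum (fw n0) x; rewrite (bigD1 i) //= (bigD1 i') /=; last by rewrite eq_sym.
rewrite wi wm'; set s := (X in _ + (_ + X)).
have s0 : 0 <= s by apply: sumr_ge0 => j _; apply: fm_ge0 (fw n0) _ _.
move: s s0 => s; lia.
Qed.

End Codes.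

Lemma invariant_of_closed (T : choiceType) (E : set (T * T)) (A : set T) :
  (forall x y, E (x, y) -> A x -> A y) -> invariant_set E A.
Proof.
move=> cA; exists [set C | components setT E C /\ C `<=` A]; first by move=> C [].
apply/seteqP; split=> [x Ax|x [C [_ CA] Cx]]; last exact: CA.
exists (component_of (induced_edges setT E) x); last by exists [::].
split; first by exists x.
move=> y [p xp yp]; apply: (@reach_closed _ (adj (induced_edges setT E)) A x) => //.
  by move=> u v Au /set_mem[/= uv _]; apply: cA uv Au.
by exists p.
Qed.

Lemma one_ended_regular_gt0 (T : choiceType) (E : set (T * T)) (d : nat) (x : T) :
  one_ended E -> regular_graph d E -> (0 < d)%N.
Proof.
move=> oE rE; case: d rE => // rE; exfalso.
have nE y z : ~ E (y, z).
  move=> yz; have := rE y; rewrite II0 card_eq0 => /eqP E0.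
  by have : [set z | E (y, z)] z by []; rewrite E0.
have cx : components setT E (component_of (induced_edges setT E) x) by exists x.
have [D [[[z [_ _] <-] inf] _]] := oE _ cx set0 (finite_set0 _) (@sub0set _ _).
apply: inf; apply: sub_finite_set (finite_set1 z) => y [p zp yp].
apply: (@reach_closed _ (adj (induced_edges (component_of (induced_edges setT E) x `\` set0) E))
  [set z] z) => //; last by exists p.
by move=> u v _ /set_mem[/= /nE].
Qed.

Lemma admissible_unit_weight (X : topologicalType) (d : nat) (g : 'I_d -> X -> X)
    (U : nat -> set X) (E : set (X * X)) :
  hausdorff_space X -> open_base U -> (forall i A, borel A -> borel (g i @^-1` A)) ->
  (0 < d)%N -> simple_graph E -> (forall x y, E (x, y) <-> exists i, g i x = y) ->
  one_ended E -> admissible g (unit_weight E).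
Proof.
move=> hX bU bg d0 sgE gE oE; split; [exact: unit_fm|exact: unit_ends_ok|].
move=> u v k.
have bE : borel [set x | E (walk g u x, walk g v x)].
  rewrite (_ : [set x | _] = [set x | exists i, walk g (u ++ [:: i]) x = walk g v x]).
    by apply: borel_ex => i; apply: (borel_eq_walk hX bU bg).
  apply/seteqP; split=> x /=; first by move=> /gE[i gi]; exists i; rewrite walk_cat.
  by move=> [i gi]; apply/gE; exists i; rewrite -gi walk_cat.
rewrite (_ : [set x | _] = [set x | (E (walk g u x, walk g v x) /\ k = 1%R) \/
    (~ E (walk g u x, walk g v x) /\ k = 0%R)]).
  by apply: borel_or; apply: borel_and => //; try exact: borel_const; exact: borel_not.
apply/seteqP; split=> x /=; rewrite /unit_weight.
  by case: ifP => [/adjP ? <-|/negP n <-]; [left|right; split=> // ?; apply/n/adjP].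
case=> -[Euv ->]; first by rewrite (_ : adj _ _ _) //; apply/adjP.
by case: ifP => // /adjP.
Qed.

Theorem theorem1p2 (R : realType) (X : topologicalType) (d : nat)
    (E : set (X * X)) :
  polish R X ->
  borel_graph E ->
  bipartite E ->
  one_ended E ->
  regular_graph d E ->
  exists X' : set X,
    [/\ invariant_set E X', comeagre X', borel X' &
        exists M : set (X * X), borel_perfect_matching X' E M].
Proof.
move=> pX [sgE bE] bipE oE rE.
have [[x0 _]|nX] := pselect (exists x : X, True); last first.
  have X0 (T : set X) : T = set0 by apply/seteqP; split=> // x; case: nX; exists x.
  exists set0; split.
  - exact: invariant_of_closed.
  - by apply: nowhere_dense_meagre; apply: X0.
  - exact: borel_set0.
  - exists set0; split=> //; exact: borel_set0.
have [dist cd] := polish_complete_dist pX; have [sX _] := pX.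
have hX := dist_hausdorff cd.
have [U bU] := polish_base cd sX x0.
have [g [bg Eg gs g_inj]] := borel_neighbours cd sX x0 bE rE.
have gE x y : E (x, y) <-> exists i, g i x = y.
  by split=> [/gs//|[i <-]]; apply: Eg.
have g_sym x i : exists j, g j (g i x) = x.
  by apply/gE; apply: sgE.2; apply: Eg.
have [chi chiE] := two_coloring sgE bipE.
have chi_g x i : chi (g i x) = ~~ chi x by apply: chiE; apply: Eg.
have d0 := one_ended_regular_gt0 x0 oE rE.
have [X' [iX' cX' bX' mX']] := generic_matching hX bU bg g_inj g_sym chi_g d0 gE
  (admissible_unit_weight hX bU bg d0 sgE gE oE).
exists X'; split=> //; apply: invariant_of_closed => x y /gE[i <-]; exact: iX'.
Qed.
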